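(* Let $\mu\in\mathcal{P}$ and $f_\mu\in Y'$. Let $x_\mu\in X=L_2(I)^n$ be the unique element with $b_\mu(x_\mu,y)=f_\mu(y)$ for all $y\in Y$. Then $\dim X_\mu^{\mathcal N}=\dim Y^{\mathcal N}=\mathcal N:=nK+d$, there is a unique $x_\mu^{\mathcal N}\in X_\mu^{\mathcal N}$ with $$b_\mu(x_\mu^{\mathcal N},y^{\mathcal N})=f_\mu(y^{\mathcal N})\qquad\text{for all }y^{\mathcal N}\in Y^{\mathcal N},$$ and $\beta_\mu^{\mathcal N}=\beta_\mu=\gamma_\mu=1$, where $$\gamma_\mu:=\sup_{0\neq x\in X}\sup_{0\neq y\in Y}\frac{b_\mu(x,y)}{\|x\|_{L_2}|||y|||_\mu},\quad \beta_\mu:=\inf_{0\neq x\in X}\sup_{0\neq y\in Y}\frac{b_\mu(x,y)}{\|x\|_{L_2}|||y|||_\mu},\quad \beta_\mu^{\mathcal N}:=\inf_{0\neq x\in X_\mu^{\mathcal N}}\sup_{0\neq y\in Y^{\mathcal N}}\frac{b_\mu(x,y)}{\|x\|_{L_2}|||y|||_\mu}.$$ Consequently, the error–residual identity $$\|x_\mu-x_\mu^{\mathcal N}\|_{L_2}=\inf_{v\in X_\mu^{\mathcal N}}\|x_\mu-v\|_{L_2}=|||r(x_\mu^{\mathcal N})|||_\mu'$$ holds, where for $\tilde x\in L_2(I)^n$ the residual $r(\tilde x)\in Y'$ is $r(\tilde x)[y]:=f_\mu(y)-b_\mu(\tilde x,y)$, $y\in Y$.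
   Context: Let $n\in\mathbb{N}$, $T>0$, $I=(0,T)$, and let $\mathcal{P}\subset\mathbb{R}^P$ be compact. Let $E\in\mathbb{R}^{n\times n}$ (typically singular) and, for each $\mu\in\mathcal{P}$, let $A_\mu\in\mathbb{R}^{n\times n}$. It is assumed throughout that for every $\mu\in\mathcal{P}$ the matrix pencil $\{E,-A_\mu\}$ is regular, i.e. $\det(\lambda E-A_\mu)\neq 0$ for some $\lambda\in\mathbb{R}$. Write $(\cdot,\cdot)_{L_2}$ and $\|\cdot\|_{L_2}$ for the inner product and norm of $X:=L_2(I)^n=L_2(I;\mathbb{R}^n)$. Let $$Y:=H^1_E(I)^n:=\{v\in H^1(I)^n:\ v(T)\in\ker(E^T)\},\qquad B_\mu^*y:=-E^T\dot y-A_\mu^T y\quad (y\in Y),$$ with $\dot y$ the weak derivative. The space $Y$ is equipped with the norm $|||y|||_\mu:=\|B_\mu^*y\|_{L_2}$. The dual $Y'$ (for the parameter $\mu$) consists of the linear functionals $f$ on $Y$ bounded with respect to $|||\cdot|||_\mu$, with norm $|||f|||_\mu':=\sup_{0\ne y\in Y} f(y)/|||y|||_\mu$. The bilinear form is $b_\mu:X\times Y\to\mathbb{R}$, $b_\mu(x,y):=(x,B_\mu^*y)_{L_2}$. (For every $f_\mu\in Y'$ the problem $b_\mu(x_\mu,y)=f_\mu(y)$ for all $y\in Y$ has a unique solution $x_\mu\in X$.) Discretization: let $K\in\mathbb{N}$, $\Delta t:=T/K$, $t_k:=k\Delta t$ for $k=0,\dots,K$, and let $\sigma_k:\bar I\to\mathbb{R}$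 be the continuous piecewise linear (hat) function with respect to these nodes with $\sigma_k(t_\ell)=\delta_{k\ell}$. Let $d:=\dim\ker E^T$, let $\{v_1,\dots,v_d\}$ be a basis of $\ker E^T$, and let $e_1,\dots,e_n$ be the canonical basis of $\mathbb{R}^n$. Put $$Y^{\mathcal N}:=\mathrm{span}\{e_i\sigma_k:\ k=0,\dots,K-1,\ i=1,\dots,n\}\oplus\mathrm{span}\{v_i\sigma_K:\ i=1,\dots,d\}\subset Y,\qquad X_\mu^{\mathcal N}:=B_\mu^*Y^{\mathcal N}\subset X.$$ *)

(* Defs.v *)
From HB Require Import structures.
From mathcomp Require Import all_boot all_order all_algebra.
From mathcomp Require Import all_classical all_reals all_analysis.

Set Implicit Arguments.
Unset Strict Implicit.
Unset Printing Implicit Defensive.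
Import Order.TTheory GRing.Theory Num.Theory.
Import numFieldNormedType.Exports.

Local Open Scope classical_set_scope.
Local Open Scope ring_scope.

(* Elements of L_2(I) and L_2(I)^n, I = (0,T), are handled through
   representatives defined on all of R; only their values on I matter, and
   equality in L_2(I)^n is equality almost everywhere on I. *)

Section scalar_functions.
Context {R : realType}.
Implicit Types (T : R) (u g phi : R -> R).

(* The extension of u by 0 outside I is square integrable. *)
Definition L2 T u : Prop :=
  (u \_ `]0, T[%classic : measurableTypeR R -> R) \in Lfun lebesgue_measure 2%:E.

(* C_c^oo(I) *)
Definition test_function T phi : Prop :=
  [/\ forall k t, derivable (derive1n k phi) t 1,
      compact (closure [set t | phi t != 0]) &
      closure [set t | phi t != 0] `<=` `]0, T[%classic].

Definition is_weak_derivative T u g : Prop :=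
  forall phi, test_function T phi ->
    \int[lebesgue_measure]_(t in `]0, T[) (u t * derive1 phi t) =
    - \int[lebesgue_measure]_(t in `]0, T[) (g t * phi t).

(* A class of H^1(I) is represented by its representative that is continuous on
   [0, T], so that its value at T is the value of the representative. *)
Definition H1 T u : Prop :=
  [/\ L2 T u, {within `[0, T], continuous u} &
      exists g, L2 T g /\ is_weak_derivative T u g].

(* A weak derivative in L_2(I); it is unique up to a null set. *)
Definition weak_derivative T u : R -> R :=
  xget (cst 0) [set g | L2 T g /\ is_weak_derivative T u g].

(* sigma_k for the nodes t_l = l * (T / K); the restriction of this function to
   [0, T] is the half hat when k = 0 or k = K. *)
Definition hat T (K k : nat) (t : R) : R :=
  Num.max 0 (1 - `|t - k%:R * (T / K%:R)| / (T / K%:R)).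

Lemma hat_node T (K k l : nat) : 0 < T -> (0 < K)%N ->
  hat T K k (l%:R * (T / K%:R)) = (k == l)%:R.
Proof.
move=> T0 K0; have d0 : 0 < T / K%:R by rewrite divr_gt0 ?ltr0n.
rewrite /hat -mulrBl normrM (gtr0_norm d0) mulfK ?(gt_eqF d0)//.
have [->|kl] := eqVneq k l; first by rewrite subrr normr0 subr0 max_r.
apply/max_idPl; rewrite subr_le0 !pmulrn -intrB -intr_norm (ler_int _ 1).
by rewrite -gtz0_ge1 normr_gt0 subr_eq0 eqz_nat eq_sym.
Qed.

End scalar_functions.

Section vector_functions.
Context {R : realType} {n : nat}.
Implicit Types (T : R) (x y : R -> 'cV[R]_n) (S : set (R -> 'cV[R]_n)).

Definition coord (i : 'I_n) y : R -> R := fun t => y t i ord0.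

(* X = L_2(I)^n *)
Definition X T : set (R -> 'cV[R]_n) := [set x | forall i, L2 T (coord i x)].

Definition eqX T x y : Prop := x = y %[ae lebesgue_measure in `]0, T[%classic].

Definition nonzero T : set (R -> 'cV[R]_n) := [set x | ~ eqX T x 0].

Definition innerX T x y : R :=
  \int[lebesgue_measure]_(t in `]0, T[) \sum_i coord i x t * coord i y t.

Definition normX T x : R := Num.sqrt (innerX T x x).

(* S has dimension N modulo equality almost everywhere on I, i.e. it has a basis
   with N elements. *)
Definition has_dim T S (N : nat) : Prop :=
  exists b : 'I_N -> R -> 'cV[R]_n,
    [/\ forall i, S (b i),
        forall c : 'I_N -> R, eqX T (\sum_i c i *: b i) 0 -> forall i, c i = 0 &
        forall x, S x -> exists c : 'I_N -> R, eqX T x (\sum_i c i *: b i)].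

End vector_functions.

Section dae.
Context {R : realType} {n : nat}.
Implicit Types (T : R) (E A : 'M[R]_n) (x y : R -> 'cV[R]_n).
Implicit Types f : (R -> 'cV[R]_n) -> R.

Definition kerT E : {vspace 'cV[R]_n} :=
  lker (linfun (mulmx E^T : 'cV[R]_n -> 'cV[R]_n)).

(* Y = H^1_E(I)^n *)
Definition Y T E : set (R -> 'cV[R]_n) :=
  [set y | (forall i, H1 T (coord i y)) /\ y T \in kerT E].

(* B_mu^* for A = A_mu *)
Definition Bstar T E A y : R -> 'cV[R]_n := fun t =>
  - (E^T *m \col_i weak_derivative T (coord i y) t) - A^T *m y t.

Definition normY T E A y : R := normX T (Bstar T E A y).

Definition b T E A x y : R := innerX T x (Bstar T E A y).

(* Y'. Linearity and boundedness force f to take the same value on two elements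
   of Y that agree almost everywhere on I. *)
Definition dualY T E A f : Prop :=
  (forall (a : R) y z, Y T E y -> Y T E z -> f (a *: y + z) = a * f y + f z) /\
  (exists C : R, forall y, Y T E y -> `|f y| <= C * normY T E A y).

Definition dual_norm T E A f : \bar R :=
  ereal_sup [set (f y / normY T E A y)%:E | y in Y T E `&` nonzero T].

Definition residual T E A f x : (R -> 'cV[R]_n) -> R :=
  fun y => f y - b T E A x y.

Definition sup_quotient T E A (V : set (R -> 'cV[R]_n)) x : \bar R :=
  ereal_sup [set (b T E A x y / (normX T x * normY T E A y))%:E
            | y in V `&` nonzero T].

Definition gamma T E A : \bar R :=
  ereal_sup [set sup_quotient T E A (Y T E) x | x in X T `&` nonzero T].

(* inf-sup constant of b_mu on the pair (U, V) *)
Definition infsup T E A (U V : set (R -> 'cV[R]_n)) : \bar R :=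
  ereal_inf [set sup_quotient T E A V x | x in U `&` nonzero T].

Definition beta T E A : \bar R := infsup T E A (X T) (Y T E).

(* Y^N for the family v_1, ..., v_d *)
Definition YN T (K d : nat) (v : d.-tuple 'cV[R]_n) : set (R -> 'cV[R]_n) :=
  [set y | exists (c : 'I_K -> 'I_n -> R) (a : 'I_d -> R), y = fun t =>
     \sum_(k < K) \sum_(i < n) c k i *: (hat T K k t *: delta_mx i ord0)
     + \sum_(j < d) a j *: (hat T K K t *: tnth v j)].

(* X_mu^N = B_mu^* Y^N, saturated under equality almost everywhere on I *)
Definition XN T E A (K d : nat) (v : d.-tuple 'cV[R]_n) : set (R -> 'cV[R]_n) :=
  [set x | X T x /\ exists2 y, YN T K v y & eqX T x (Bstar T E A y)].

Definition betaN T E A (K d : nat) (v : d.-tuple 'cV[R]_n) : \bar R :=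
  infsup T E A (XN T E A K v) (YN T K v).

End dae.

(* Main.v *)
Require Import Defs.
From HB Require Import structures.
From mathcomp Require Import all_boot all_order all_algebra.
From mathcomp Require Import all_classical all_reals all_analysis.
From mathcomp Require Import measurable_realfun.
From mathcomp Require Import ring lra.

Set Implicit Arguments.
Unset Strict Implicit.
Unset Printing Implicit Defensive.
Import Order.TTheory GRing.Theory Num.Theory.
Import numFieldNormedType.Exports.
(* coord stands for a coordinate of a vector-valued function *)
Import Defs.

Local Open Scope classical_set_scope.
Local Open Scope ring_scope.

(** Since |||y||| is the norm of B* y, the operator B* is an isometry of
    (Y, |||.|||) into L2, and everything follows once it is known to be injective
    with dense range.  For x in L2 the Cauchy-Schwarz inequality bounds
    b(x, y) / |||y||| by the norm of x, and density of B* Y makes the supremum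
    equal to it ([sup_quotient_eq1]); hence beta = gamma = 1.  On the discrete
    spaces x is itself some B* y, so betaN = 1 as well.  Injectivity of B* turns
    the hat functions, which are a basis of the test space, into a basis of the
    trial space; its Gram matrix is invertible ([gram_unit]), so there is exactly
    one Galerkin solution.  The Galerkin equations say that the error is orthogonal
    to the trial space, which is best approximation ([galerkin_best]), and the
    residual is the functional y |-> (x - xN, B* y), whose dual norm is the norm of
    the error, again by density ([error_residual]).

    Density ([Bstar_dense]) is proved with polynomials that vanish at T, which
    belong to Y whatever the kernel of E^T is.  Let L(X) = M X + N be the matrix
    symbol of a regular first-order operator M d/dt + N.  Setting y = adj(L)(D) w
    with D = d/dt reduces L(D) y = h to the scalar equations det(L)(D) w_i = h_i,
    and these are solved approximately in polynomials: after integrating deg det(L)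
    times, the partial sums of the Neumann series of a Volterra operator leave a
    factorially small remainder ([diffop_approx_surj], [pencil_approx_surj]).  For
    y to vanish at the endpoint, h has to vanish there to some fixed order B, the
    number of derivatives contained in the adjugate; polynomials divisible by
    (t - e)^B are still dense in L2 ([poly_dense_weighted]), by truncation and the
    Weierstrass theorem.

    Injectivity ([Bstar_injective]) is the dual statement.  If B* y = 0, then
    integration by parts shows that y is orthogonal to (E d/dt - A) p for every
    polynomial vector p with p(0) = 0: the boundary term at T vanishes because y(T)
    lies in the kernel of E^T.  These images are dense by the same theorem, so
    y = 0.

    Both steps rest on integration by parts of an H1 function, known only through
    its weak derivative, against a polynomial up to the boundary
    ([weak_integration_by_parts]).  The polynomial is multiplied by smooth cut-offs
    built from exp(-1/t); their derivatives concentrate at the endpoints and yield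
    the boundary terms.  The same formula shows that weak derivatives are unique, so
    that B* y can be computed from any of them. *)

(** * Linear differential equations with constant coefficients in polynomials *)

Section differential_operator.
Context {R : realType}.
Implicit Types (P Q p q u h : {poly R}) (a c : R) (i k m : nat).

(** P(D) p, where D = d/dt. *)
Definition diffop P p : {poly R} := \sum_(i < size P) P`_i *: derivn i p.

Lemma diffopE m P p : (size P <= m)%N ->
  diffop P p = \sum_(i < m) P`_i *: derivn i p.
Proof.
move=> Pm; rewrite /diffop (big_ord_widen m (fun i => P`_i *: derivn i p))//.
rewrite big_mkcond/=; apply: eq_bigr => i _; case: ltnP => // Pi.
by rewrite nth_default// scale0r.
Qed.

Lemma diffopD P Q p : diffop (P + Q) p = diffop P p + diffop Q p.
Proof.
pose m := maxn (size P) (size Q).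
rewrite (diffopE _ (size_polyD P Q)) (@diffopE m P) ?leq_maxl//.
rewrite (@diffopE m Q) ?leq_maxr// -big_split/=; apply: eq_bigr => i _.
by rewrite coefD scalerDl.
Qed.

Lemma diffopC c p : diffop c%:P p = c *: p.
Proof. by rewrite (@diffopE 1) ?size_polyC_leq1// big_ord1 coefC derivn0. Qed.

Lemma diffop0 p : diffop 0 p = 0.
Proof. by rewrite -[0]/(0%:P) diffopC scale0r. Qed.

Lemma diffopMX P p : diffop (P * 'X) p = diffop P (deriv p).
Proof.
rewrite (@diffopE (size P).+1); last first.
  by rewrite (leq_trans (size_polyMleq _ _))// size_polyX addn2.
rewrite big_ord_recl coefMX scale0r add0r; apply: eq_bigr => i _.
by rewrite coefMX -derivSn.
Qed.

Lemma diffop_sumr P (I : finType) (F : I -> {poly R}) :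
  diffop P (\sum_i F i) = \sum_i diffop P (F i).
Proof.
rewrite /diffop exchange_big/=; apply: eq_bigr => i _.
by rewrite linear_sum/= scaler_sumr.
Qed.

Lemma diffop_suml (I : finType) (F : I -> {poly R}) p :
  diffop (\sum_i F i) p = \sum_i diffop (F i) p.
Proof.
by elim/big_rec2: _ => [|i y x _ <-]; rewrite ?diffop0 ?diffopD.
Qed.

Lemma diffopZr P c : {morph diffop P : p / c *: p}.
Proof.
move=> p; rewrite /diffop scaler_sumr; apply: eq_bigr => i _.
by rewrite linearZ/= !scalerA mulrC.
Qed.

Lemma deriv_diffop P p : deriv (diffop P p) = diffop P (deriv p).
Proof.
rewrite /diffop linear_sum/=; apply: eq_bigr => i _.
by rewrite linearZ/= -derivnS derivSn.
Qed.

(** Composing operators multiplies symbols: this is what turns the adjugate of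
    a matrix of symbols into a matrix of differential operators. *)
Lemma diffopM P Q p : diffop (P * Q) p = diffop P (diffop Q p).
Proof.
elim/poly_ind: P p => [p|P c IH p]; first by rewrite mul0r !diffop0.
rewrite mulrDl -mulrA (mulrC 'X) mulrA !diffopD !diffopMX IH deriv_diffop.
rewrite diffopC -diffopZr; congr (_ + _).
elim/poly_ind: Q p {IH} => [q|Q d IHQ q]; first by rewrite mulr0 !diffop0.
rewrite mulrDr mulrA !diffopD !diffopMX IHQ linearZ/= -polyCM !diffopC.
by rewrite scalerA mulrC.
Qed.

End differential_operator.

Section primitive.
Context {R : realType}.
Implicit Types (P Q p q u h : {poly R}) (a c : R) (i k m : nat).

Definition prim p : {poly R} := \poly_(i < (size p).+1) (p`_i.-1 / i%:R).

Lemma coef_prim p i : (prim p)`_i = p`_i.-1 / i%:R.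
Proof.
rewrite coef_poly; case: ltnP => //; case: i => [|i]//= pi.
by rewrite nth_default// mul0r.
Qed.

Lemma prim_is_linear : linear prim.
Proof.
move=> a p q; apply/polyP => i.
by rewrite coefD coefZ !coef_prim coefD coefZ mulrDl mulrA.
Qed.
HB.instance Definition _ := GRing.isLinear.Build R {poly R} {poly R} _ prim prim_is_linear.

Lemma deriv_prim p : deriv (prim p) = p.
Proof.
apply/polyP => i; rewrite coef_deriv coef_prim/=.
by rewrite -[LHS]mulr_natr divfK// pnatr_eq0.
Qed.

Lemma derivn_iter_prim i m p : (i <= m)%N ->
  derivn i (iter m prim p) = iter (m - i) prim p.
Proof.
elim: i m => [|i IH] [|m]//.
by move=> im; rewrite derivSn /= deriv_prim IH.
Qed.

Definition order_ge k p : Prop := forall i, (i < k)%N -> p`_i = 0.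

Lemma order_ge_prim k p : order_ge k p -> order_ge k.+1 (prim p).
Proof.
move=> kp i; rewrite ltnS coef_prim; case: i => [|i] ik; first by rewrite invr0 mulr0.
by rewrite kp// mul0r.
Qed.

Lemma order_geW k m p : order_ge k p -> (m <= k)%N -> order_ge m p.
Proof. by move=> kp mk i im; apply: kp; exact: leq_trans mk. Qed.

Lemma order_ge_iter_prim k m p : order_ge k p -> order_ge (m + k) (iter m prim p).
Proof. by move=> kp; elim: m => // m IH; exact: order_ge_prim. Qed.

Lemma order_geZ k a p : order_ge k p -> order_ge k (a *: p).
Proof. by move=> kp i /kp; rewrite coefZ => ->; rewrite mulr0. Qed.

Lemma order_ge_sum k (I : finType) (F : I -> {poly R}) :
  (forall j, order_ge k (F j)) -> order_ge k (\sum_i F i).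
Proof. by move=> kF i ik; rewrite coef_sum big1// => j _; exact: kF. Qed.

Lemma diffop_at0 P p : order_ge (size P) p -> (diffop P p).[0] = 0.
Proof.
move=> Pp; rewrite /diffop horner_sum big1// => i _.
by rewrite hornerZ horner_coef0 coef_derivn addn0 Pp// mul0rn mulr0.
Qed.

Context (T : R) (T0 : 0 <= T).

(** A norm bounding |p| on the whole interval [-T, T]; unlike the supremum it is
    computed from the coefficients, on which the primitive acts diagonally. *)
Definition cnorm p : R := \sum_(i < size p) `|p`_i| * T ^+ i.

Lemma cnormE m p : (size p <= m)%N -> cnorm p = \sum_(i < m) `|p`_i| * T ^+ i.
Proof.
move=> pm; rewrite /cnorm (big_ord_widen m (fun i => `|p`_i| * T ^+ i))//.
rewrite big_mkcond/=; apply: eq_bigr => i _; case: ltnP => // pi.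
by rewrite nth_default// normr0 mul0r.
Qed.

Lemma cnorm_ge0 p : 0 <= cnorm p.
Proof. by apply: sumr_ge0 => i _; rewrite mulr_ge0// exprn_ge0. Qed.

Lemma cnormD p q : cnorm (p + q) <= cnorm p + cnorm q.
Proof.
pose m := maxn (size p) (size q).
rewrite (cnormE (size_polyD p q)) (@cnormE m p) ?leq_maxl//.
rewrite (@cnormE m q) ?leq_maxr// -big_split/=; apply: ler_sum => i _.
by rewrite coefD -mulrDl ler_wpM2r ?exprn_ge0// ler_normD.
Qed.

Lemma cnormZ a p : cnorm (a *: p) = `|a| * cnorm p.
Proof.
rewrite (@cnormE (size p)) ?size_scale_leq// mulr_sumr; apply: eq_bigr => i _.
by rewrite coefZ normrM mulrA.
Qed.

Lemma cnorm_sum (I : finType) (F : I -> {poly R}) :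
  cnorm (\sum_i F i) <= \sum_i cnorm (F i).
Proof.
elim/big_rec2: _ => [|i y x _ yx]; first by rewrite /cnorm size_poly0 big_ord0.
by rewrite (le_trans (cnormD _ _))// lerD2l.
Qed.

Lemma horner_le_cnorm p s : `|s| <= T -> `|p.[s]| <= cnorm p.
Proof.
move=> sT; rewrite horner_coef (le_trans (ler_norm_sum _ _ _))//.
by apply: ler_sum => i _; rewrite normrM ler_wpM2l// normrX lerXn2r.
Qed.

(** The gain k.+1 in the denominator is what makes iterated primitives decay
    factorially. *)
Lemma cnorm_prim k p : order_ge k p -> cnorm (prim p) <= T / k.+1%:R * cnorm p.
Proof.
move=> kp; rewrite (@cnormE (size p).+1) ?size_poly//.
rewrite big_ord_recl coef_prim invr0 mulr0 normr0 mul0r add0r mulr_sumr.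
apply: ler_sum => i _; rewrite coef_prim/=.
have [/kp ->|ki] := ltnP i k; first by rewrite mul0r normr0 !mul0r mulr0.
rewrite add0n normrM normfV [X in _ / X * _]ger0_norm//.
rewrite [leRHS](_ : _ = `|p`_i| * k.+1%:R^-1 * T ^+ i.+1); last first.
  by rewrite exprS; ring.
rewrite ler_wpM2r ?exprn_ge0// ler_wpM2l//.
by rewrite lef_pV2 ?posrE ?ltr0n// ler_nat.
Qed.

(** Only the innermost primitive contributes its gain; one factor per application
    of V suffices below. *)
Lemma cnorm_iter_prim k m p : order_ge k p ->
  cnorm (iter m.+1 prim p) <= T ^+ m.+1 / k.+1%:R * cnorm p.
Proof.
move=> kp; elim: m => [|m IH]; first exact: cnorm_prim.
rewrite iterS (le_trans (@cnorm_prim 0 _ _))// divr1 (le_trans (ler_wpM2l T0 IH))//.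
by rewrite (exprS _ m.+1) !mulrA.
Qed.

End primitive.

Section solve.
Context {R : realType}.
Implicit Types (P Q p q u h : {poly R}) (a c : R) (k m : nat).

(** Writing q(D) w = c (1 - V) u with w the deg q-fold primitive of u turns the
    equation q(D) w = h into a Volterra equation; the partial sums of its
    Neumann series leave the remainder V^N h, which tends to 0 factorially. *)
Lemma diffop_approx_surj q (T eps : R) B h : q != 0 -> 0 <= T -> 0 < eps ->
  order_ge B h ->
  exists w, order_ge B w /\ cnorm T (diffop q w - h) <= eps.
Proof.
move=> q0 T0 e0 hB; pose m := (size q).-1; pose c := lead_coef q.
have sq : size q = m.+1 by rewrite /m prednK// size_poly_gt0.
have c0 : c != 0 by rewrite lead_coef_eq0.
pose V u := \sum_(i < m) (- (q`_i / c)) *: iter (m - i) prim u.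
have qJ u : diffop q (iter m prim u) = c *: (u - V u).
  rewrite /diffop sq big_ord_recr/= derivn_iter_prim// subnn/=.
  rewrite addrC scalerBr; congr (_ + _).
  rewrite /V scaler_sumr -sumrN; apply: eq_bigr => i _.
  rewrite derivn_iter_prim 1?ltnW// scalerA mulrN scaleNr opprK.
  by rewrite mulrC divfK.
pose C := \sum_(i < m) `|q`_i / c| * T ^+ (m - i).
have C0 : 0 <= C by apply: sumr_ge0 => i _; rewrite mulr_ge0// exprn_ge0.
have ordV k u : order_ge k u -> order_ge k.+1 (V u).
  move=> ku; apply: order_ge_sum => i; apply: order_geZ.
  refine (order_geW (@order_ge_iter_prim R k (m - i) u ku) _).
  by rewrite -add1n leq_add2r subn_gt0.
(* each term of V contains at least one primitive, as i < m *)
have normV k u : order_ge k u -> cnorm T (V u) <= C / k.+1%:R * cnorm T u.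
  move=> ku; rewrite (le_trans (cnorm_sum T0 _))// /C !mulr_suml.
  apply: ler_sum => i _; rewrite cnormZ normrN -!mulrA ler_wpM2l// mulrA.
  case: (m - i)%N (subn_gt0 i m) => [|j _]; first by rewrite ltn_ord.
  exact: cnorm_iter_prim.
pose v := c^-1 *: h.
have ordN N : order_ge (N + B) (iter N V v).
  by elim: N => [|N IH]; [exact: order_geZ|exact: ordV].
have ordN' N : order_ge N (iter N V v).
  by apply: order_geW (ordN N) _; rewrite leq_addr.
have normN N : cnorm T (iter N V v) <= exp_coeff C N * cnorm T v.
  elim: N => [|N IH]; first by rewrite /exp_coeff/= fact0 expr0 divr1 mul1r.
  rewrite iterS (le_trans (normV _ _ (ordN' N)))//.
  rewrite (le_trans (ler_wpM2l _ IH)) ?divr_ge0//.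
  rewrite mulrA ler_wpM2r ?cnorm_ge0//.
  rewrite /exp_coeff/= factS natrM exprS invfM.
  by rewrite [leLHS](_ : _ = C * C ^+ N * (N.+1%:R^-1 * (N`!)%:R^-1))//; ring.
have [N HN] : exists N, `|c| * (exp_coeff C N * cnorm T v) <= eps.
  have : `|c| * (exp_coeff C N * cnorm T v) @[N --> \oo] --> `|c| * (0 * cnorm T v).
    apply: cvgM; first exact: cvg_cst.
    apply: cvgM; last exact: cvg_cst.
    exact: (cvg_series_cvg_0 (is_cvg_series_exp_coeff C)).
  rewrite mul0r mulr0 => /cvgrPdist_le/(_ _ e0)[N _ /(_ _ (leqnn N))].
  by rewrite /= sub0r normrN => NE; exists N; exact: le_trans (ler_norm _) NE.
exists (iter m prim (\sum_(k < N) iter k V v)); split.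
  refine (order_geW _ (leq_addl m B)); apply: order_ge_iter_prim.
  apply: order_ge_sum => k; exact: (order_geW (ordN k) (leq_addl _ _)).
have VB : {morph V : x y / x - y}.
  move=> x y; rewrite /V -sumrB; apply: eq_bigr => i _; rewrite -scalerBr.
  by congr (_ *: _); elim: (m - i)%N => //= k ->; rewrite linearB.
have V0 : V 0 = 0 by have := VB 0 0; rewrite !subrr.
have VD : {morph V : x y / x + y}.
  have VN x : V (- x) = - V x by rewrite -sub0r VB V0 sub0r.
  by move=> x y; rewrite -{1}(opprK y) VB VN opprK.
have -> : diffop q (iter m prim (\sum_(k < N) iter k V v)) - h
          = - c *: iter N V v.
  rewrite qJ; suff -> : \sum_(k < N) iter k V v - V (\sum_(k < N) iter k V v)
                        = v - iter N V v.
    by rewrite scalerBr scalerA divff// scale1r addrAC subrr sub0r scaleNr.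
  elim: N {HN} => [|N IH].
    by rewrite !big_ord0 V0 !subrr.
  rewrite !big_ord_recr/= VD opprD addrACA IH; ring.
rewrite cnormZ normrN (le_trans _ HN)// ler_wpM2l//.
Qed.

(** The adjugate of the symbol M X + N reduces a regular first-order system to
    scalar equations with symbol det (M X + N).  The order B of vanishing of
    the right-hand side is consumed by the derivatives in the adjugate. *)
Lemma pencil_approx_surj n (M N : 'M[R]_n) (T e : R) :
  (exists lambda, \det (lambda *: M + N) != 0) -> 0 <= T ->
  exists B : nat, forall (p : 'I_n -> {poly R}) (eps : R), 0 < eps ->
  exists y : 'I_n -> {poly R}, (forall j, (y j).[e] = 0) /\
  forall (i : 'I_n) t, `|t - e| <= T ->
    `|\sum_j (M i j * (deriv (y j)).[t] + N i j * (y j).[t])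
      - (t - e) ^+ B * (p i).[t]| <= eps.
Proof.
move=> [lambda regM] T0.
pose L : 'M[{poly R}]_n := \matrix_(i, j) ((M i j)%:P * 'X + (N i j)%:P).
have q0 : \det L != 0.
  apply: contraNneq regM => L0.
  have := congr1 (horner_eval lambda) L0.
  rewrite -det_map_mx raddf0 => <-; apply/eqP; congr (\det _).
  apply/matrixP => i j; by rewrite !mxE/= /horner_eval !hornerE mulrC.
pose B := (\max_(ij : 'I_n * 'I_n) size (\adj L ij.1 ij.2))%N.
have sB (i j : 'I_n) : (size (\adj L i j) <= B)%N by exact: (leq_bigmax (i, j)).
exists B => p eps e0.
pose h i := 'X^B * (p i \Po ('X + e%:P)).
have hB i : order_ge B (h i) by move=> k kB; rewrite coefXnM kB.
have [w wP] := choice (fun i => diffop_approx_surj q0 T0 e0 (hB i)).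
(* y = adj(L)(D) w gives L(D) y = det(L)(D) w, componentwise close to h *)
pose y i := (\sum_j diffop (\adj L i j) (w j)).
exists (fun i => y i \Po ('X - e%:P)); split.
  move=> i; rewrite horner_comp !hornerE subrr /y horner_sum big1// => j _.
  apply: diffop_at0; refine (order_geW _ (sB i j)); by case: (wP j).
move=> i t te.
have dy j : (deriv (y j \Po ('X - e%:P))).[t] = (deriv (y j)).[t - e].
  by rewrite deriv_comp derivXsubC mulr1 horner_comp !hornerE.
have -> : \sum_j (M i j * (deriv (y j \Po ('X - e%:P))).[t] +
    N i j * (y j \Po ('X - e%:P)).[t]) = (diffop (\det L) (w i)).[t - e].
  have -> : diffop (\det L) (w i) = \sum_j diffop (L i j) (y j).
    under eq_bigr do rewrite /y diffop_sumr.
    rewrite exchange_big/=.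
    under eq_bigr => k _ do
      (under eq_bigr do rewrite -diffopM; rewrite -diffop_suml).
    have LA l : \sum_j L i j * \adj L j l = (\det L) *+ (i == l).
      by have /matrixP/(_ i l) := mul_mx_adj L; rewrite !mxE.
    under eq_bigr do rewrite LA.
    rewrite (bigD1 i)//= eqxx big1 ?addr0// => j; rewrite eq_sym => /negbTE ->.
    by rewrite diffop0.
  rewrite horner_sum; apply: eq_bigr => j _.
  rewrite dy horner_comp !hornerE /L mxE diffopD diffopMX !diffopC.
  by rewrite !hornerE.
have -> : (t - e) ^+ B * (p i).[t] = (h i).[t - e].
  by rewrite /h hornerM horner_comp !hornerE subrK.
rewrite -hornerN -hornerD; have [_] := wP i.
by apply: le_trans; exact: horner_le_cnorm.
Qed.

End solve.

(** * Smooth functions and cut-offs *)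

Section smooth.
Context {R : realType}.
Implicit Types (p q : {poly R}) (h : R -> R).

(** The functions p(1/t) exp(-1/t) extended by 0: their derivatives are again of
    this form. *)
Definition flat p (t : R) : R :=
  if 0 < t then p.[t^-1] * expR (- t^-1) else 0.

(** A syntactic class of functions rather than the condition that all iterated
    derivatives exist: it is closed under derivation, so a single derivative of
    each constructor gives all orders at once. *)
Inductive smooth : (R -> R) -> Prop :=
| smooth_horner p : smooth (horner p)
| smooth_flat p : smooth (flat p)
| smooth_affine a b h : smooth h -> smooth (fun t => h (a * t + b))
| smoothD h1 h2 : smooth h1 -> smooth h2 -> smooth (fun t => h1 t + h2 t)
| smoothM h1 h2 : smooth h1 -> smooth h2 -> smooth (fun t => h1 t * h2 t)
| smoothV h : (forall t, h t != 0) -> smooth h -> smooth (fun t => (h t)^-1).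

Lemma horner_le_expR p : exists2 C, 0 <= C &
  forall s, 0 <= s -> `|p.[s]| <= C * expR s.
Proof.
exists (\sum_(i < size p) `|p`_i| * (i`!)%:R) => [|s s0].
  by apply: sumr_ge0 => i _; rewrite mulr_ge0.
rewrite horner_coef (le_trans (ler_norm_sum _ _ _))// mulr_suml.
apply: ler_sum => i _; rewrite normrM -mulrA ler_wpM2l// ger0_norm ?exprn_ge0//.
case: (nat_of_ord i) => [|k].
  by rewrite expr0 fact0 mul1r (le_trans _ (expR_ge1Dx s))// lerDl.
rewrite mulrC -ler_pdivrMr ?ltr0n ?fact_gt0//.
by apply: le_trans (expR_ge1Dxn k s0); rewrite lerDr.
Qed.

(** The quadratic bound is what makes flat p differentiable at 0. *)
Lemma flat_le_sqr p : exists2 C, 0 <= C & forall t, `|flat p t| <= C * t ^+ 2.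
Proof.
have [C C0 HC] := horner_le_expR ('X^2 * p).
exists C => // t; rewrite /flat; case: ifPn => [t0|_]; last first.
  by rewrite normr0 mulr_ge0// sqr_ge0.
have := HC t^-1; rewrite invr_ge0 ltW// => /(_ isT).
rewrite hornerM hornerXn !normrM (ger0_norm (expR_ge0 _)) expRN.
rewrite normfV (gtr0_norm t0) ler_pdivrMr ?expR_gt0// => le1.
have -> : `|p.[t^-1]| = t ^+ 2 * (t^-1 / t * `|p.[t^-1]|).
  by field; rewrite gt_eqF.
by rewrite [leRHS]mulrAC [leRHS]mulrC; apply: ler_wpM2l => //; exact: sqr_ge0.
Qed.

Lemma is_derive_0 (h : R -> R) (C : R) :
  h 0 = 0 -> (forall t, `|h t| <= C * t ^+ 2) -> is_derive (0 : R) (1 : R) h 0.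
Proof.
move=> h0 hC.
have C0 : 0 <= C by have := hC 1; rewrite expr1n mulr1; exact: le_trans.
have cv : (fun x : R => x^-1 *: (h (x *: 1 + 0) - h 0)) @ 0^' --> (0 : R).
  apply/cvgrPdist_le => e e0; near=> x.
  have x0 : x != 0 by near: x; exact: nbhs_dnbhs_neq.
  rewrite h0 subr0 addr0 sub0r normrN scaler1 normrM normfV.
  rewrite ler_pdivrMl ?normr_gt0// (le_trans (hC _))//.
  rewrite -real_normK ?num_real// expr2 mulrCA ler_wpM2l//.
  have : `|x| <= e / (C + 1).
    near: x; apply: dnbhs0_le; by rewrite divr_gt0// ltr_wpDl.
  rewrite ler_pdivlMr ?ltr_wpDl// => xe; apply: le_trans xe.
  by rewrite mulrC ler_wpM2l// lerDl.
apply: DeriveDef; last exact: cvg_lim cv.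
by apply/cvg_ex; exists 0.
Unshelve. all: by end_near. Qed.

Lemma is_derive_flat p (t : R) :
  is_derive t (1 : R) (flat p) (flat ('X^2 * (p - deriv p)) t).
Proof.
have [t0|t0|->] := ltgtP t 0.
- have -> : flat ('X^2 * (p - deriv p)) t = 0 by rewrite /flat ltNge ltW.
  apply: (@near_eq_is_derive _ R R (cst (0 : R))).
  near=> s; rewrite /flat ltNge ltW//=; near: s; exact: lt_nbhsl.
- apply: (@near_eq_is_derive _ R R (fun s => p.[s^-1] * expR (- s^-1))).
    near=> s; rewrite /flat ifT//; near: s; exact: lt_nbhsr.
  have tn0 : t != 0 by rewrite gt_eqF.
  have dV : is_derive t 1 (fun s : R => s^-1) (- t ^- 2).
    have did : derivable (id : R -> R) t 1 by exact: derivable_id.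
    apply: DeriveDef; first exact: (@derivableV R R id).
    by rewrite (@deriveV R R id)// derive_id /GRing.scale/= mulr1.
  have dp : is_derive t 1 (fun s : R => p.[s^-1]) ((deriv p).[t^-1] * - t ^- 2).
    exact: (is_derive1_comp (is_derive_poly p _) dV).
  have de : is_derive t 1 (fun s : R => expR (- s^-1)) (expR (- t^-1) * t ^- 2).
    have dN : is_derive t 1 (fun s : R => - s^-1) (t ^- 2).
      by apply: (is_derive_eq (is_deriveN dV)); rewrite opprK.
    exact: (is_derive1_comp (is_derive_expR _) dN).
  apply: (is_derive_eq (is_deriveM dp de)).
  rewrite /flat t0 !hornerE -exprVn /GRing.scale/=; ring.
- have [C _ HC] := flat_le_sqr p.
  have f0 q : flat q 0 = 0 by rewrite /flat ltxx.
  by rewrite f0; apply: is_derive_0 HC; rewrite f0.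
Unshelve. all: by end_near. Qed.

Lemma is_derive_affine (F f : R -> R) (e b : R) :
  (forall t : R, is_derive t (1 : R) F (f t)) ->
  forall t : R, is_derive t (1 : R) (fun s => F (e * s + b)) (e * f (e * t + b)).
Proof.
move=> dF t; have da : is_derive t (1 : R) (fun s : R => e * s + b) e.
  have := is_derive_poly (e%:P * 'X + b%:P) t.
  rewrite (_ : horner _ = fun s : R => e * s + b); last first.
    by apply/funext => s; rewrite !hornerE.
  move=> H; apply: (is_derive_eq H).
  by rewrite derivD derivM !derivC derivX !hornerE.
have H := is_derive1_comp (g := fun s => e * s + b) (dF _) da.
by rewrite mulrC; exact: H.
Qed.

Lemma smooth_is_derive h : smooth h ->
  exists2 h', smooth h' & forall t : R, is_derive t (1 : R) h (h' t).
Proof.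
elim => {h} [p|p|a b h _ [h' sh' dh]|h1 h2 _ [h1' s1 d1] _ [h2' s2 d2]|
  h1 h2 s1' [h1' s1 d1] s2' [h2' s2 d2]|h h0 sh [h' sh' dh]].
- by exists (horner (deriv p)) => // [|t]; [exact: smooth_horner|exact: is_derive_poly].
- exists (flat ('X^2 * (p - deriv p))); first exact: smooth_flat.
  by move=> t; exact: is_derive_flat.
- exists (fun t => (a%:P).[t] * h' (a * t + b)).
    by apply: smoothM; [exact: smooth_horner|exact: smooth_affine].
  by move=> t; rewrite hornerC; exact: is_derive_affine.
- by exists (fun t => h1' t + h2' t) => [|t]; [exact: smoothD|exact: is_deriveD].
- exists (fun t => h1 t * h2' t + h2 t * h1' t).
    by apply: smoothD; exact: smoothM.
  by move=> t; exact: is_deriveM.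
- exists (fun t => (-1)%:P.[t] * (((h t)^-1 * (h t)^-1) * h' t)).
    apply: smoothM; first exact: smooth_horner.
    by apply: smoothM => //; apply: smoothM; exact: smoothV.
  move=> t; have [dv dE] := dh t.
  apply: DeriveDef; first exact: derivableV.
  rewrite deriveV// dE hornerC mulN1r -invrM ?unitfE// -expr2.
  by rewrite /GRing.scale/= mulNr.
Qed.

Lemma smooth_derivable h t : smooth h -> derivable h t 1.
Proof. by case/smooth_is_derive => h' _ /(_ t)[]. Qed.

Lemma smooth_continuous h : smooth h -> continuous h.
Proof.
move=> sh t; apply/differentiable_continuous/derivable1_diffP.
exact: smooth_derivable.
Qed.

Lemma smooth_derive1 h : smooth h -> smooth (derive1 h).
Proof.
case/smooth_is_derive => h' sh' dh; suff -> : derive1 h = h' by [].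
by apply/funext => t; rewrite derive1E; have [_ ->] := dh t.
Qed.

Lemma smooth_derive1n k h : smooth h -> smooth (derive1n k h).
Proof. by move=> sh; elim: k => [|k IH]//; rewrite /derive1n iterS; exact: smooth_derive1. Qed.

(** The standard smooth transition from 0 on the negative axis to 1 beyond 1. *)
Definition step (t : R) : R := flat 1 t * (flat 1 t + flat 1 (- 1 * t + 1))^-1.

Lemma flat1_ge0 (t : R) : 0 <= flat 1 t.
Proof. by rewrite /flat; case: ifP => // _; rewrite hornerE mul1r expR_ge0. Qed.

Lemma flat1_gt0 (t : R) : 0 < t -> 0 < flat 1 t.
Proof. by rewrite /flat => ->; rewrite hornerE mul1r expR_gt0. Qed.

Lemma step_den_gt0 (t : R) : 0 < flat 1 t + flat 1 (- 1 * t + 1).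
Proof.
have [t0|t0] := ltP 0 t; first by rewrite ltr_pwDl ?flat1_gt0 ?flat1_ge0.
by rewrite ltr_wpDl ?flat1_ge0// flat1_gt0//; lra.
Qed.

Lemma smooth_step : smooth step.
Proof.
apply: smoothM; first exact: smooth_flat.
apply: smoothV => [t|]; first by rewrite gt_eqF// step_den_gt0.
by apply: smoothD; [|apply: smooth_affine]; exact: smooth_flat.
Qed.

Lemma step_eq0 t : t <= 0 -> step t = 0.
Proof. by move=> t0; rewrite /step [X in X * _]/flat ltNge t0 mul0r. Qed.

Lemma step_eq1 t : 1 <= t -> step t = 1.
Proof.
move=> t1; rewrite /step.
have -> : flat 1 (- 1 * t + 1) = 0 by rewrite /flat ltNge; case: leP => //; lra.
by rewrite addr0 divff// gt_eqF// flat1_gt0//; lra.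
Qed.

Lemma step_ge0 t : 0 <= step t.
Proof. by rewrite /step divr_ge0 ?flat1_ge0// ltW// step_den_gt0. Qed.

Lemma step_le1 t : step t <= 1.
Proof. by rewrite /step ler_pdivrMr ?step_den_gt0// mul1r lerDl flat1_ge0. Qed.

End smooth.

(** * The inner product of vector-valued square-integrable functions *)

Section scalar_L2.
Context {R : realType} (T : R).
Notation mu := (@lebesgue_measure R).
Notation D := (`]0, T[%classic : set R).
Implicit Types (u v : R -> R) (a : R).

Let mD : measurable (D : set (measurableTypeR R)).
Proof. exact: measurable_itv. Qed.

Lemma finite_mu_itv : (mu D < +oo)%E.
Proof. by rewrite lebesgue_measure_itv/=; case: ifPn => _; rewrite ltry. Qed.

Lemma L2P u : L2 T u <->
  measurable_fun D u /\ mu.-integrable D (EFin \o (fun t => u t ^+ 2)).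
Proof.
have rE : (fun t => (u \_ D) t ^+ 2) = (fun t => u t ^+ 2) \_ D.
  by apply/funext => t; rewrite /patch; case: ifP => // _; rewrite expr0n.
rewrite /L2; split => [uL|[mu_ iu]].
  split.
    by apply/(measurable_restrictT u mD); move: uL => /sub_Lfun_mfun; rewrite inE.
  move/Lfun2_integrable_sqr: uL; rewrite rE -restrict_EFin => iu.
  exact/(integrable_mkcond _ mD).
have mr : measurable_fun setT (u \_ D) by exact/(measurable_restrictT u mD).
rewrite inE/=; apply/andP; split; first by rewrite inE.
rewrite inE/= /finite_norm unlock poweR_lty//=.
have : mu.-integrable setT (EFin \o (fun t => (u \_ D) t ^+ 2)).
  by rewrite rE -restrict_EFin; apply/(integrable_mkcond _ mD).
case/integrableP => _; apply: le_lt_trans.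
rewrite ge0_le_integral//.
- apply/measurable_EFinP; apply: (measurableT_comp (measurable_powR _)).
  exact: measurableT_comp.
- by apply/measurable_EFinP; apply: measurableT_comp => //; exact: measurable_funX.
- by move=> t _ /=; rewrite lee_fin powR_mulrn// normrX.
Qed.

Lemma L2_measurable u : L2 T u -> measurable_fun D u.
Proof. by case/L2P. Qed.

Lemma L2_mul_integrable u v : L2 T u -> L2 T v ->
  mu.-integrable D (EFin \o (fun t => u t * v t)).
Proof.
move=> /L2P[mu_ iu] /L2P[mv iv].
have := integrableD mD iu iv; apply: le_integrable => //.
  by apply/measurable_EFinP; exact: measurable_funM.
move=> t _ /=; rewrite lee_fin [leRHS]ger0_norm ?addr_ge0 ?sqr_ge0// ler_norml.
by have := sqr_ge0 (u t + v t); have := sqr_ge0 (u t - v t);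
  have := sqr_ge0 (u t); have := sqr_ge0 (v t); nra.
Qed.

Lemma L2D u v : L2 T u -> L2 T v -> L2 T (fun t => u t + v t).
Proof.
move=> /L2P[mu_ iu] /L2P[mv iv]; apply/L2P; split; first exact: measurable_funD.
have := integrableD mD (integrableZl mD 2 iu) (integrableZl mD 2 iv).
apply: le_integrable => //.
  by apply/measurable_EFinP; apply: measurable_funX; exact: measurable_funD.
move=> t _ /=; rewrite lee_fin [leLHS]ger0_norm ?sqr_ge0// [leRHS]ger0_norm; last first.
  by rewrite addr_ge0// mulr_ge0// sqr_ge0.
by have := sqr_ge0 (u t - v t); nra.
Qed.

Lemma L2Z a u : L2 T u -> L2 T (fun t => a * u t).
Proof.
move=> /L2P[mu_ iu]; apply/L2P; split; first exact: measurable_funM.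
have := integrableZl mD (a ^+ 2) iu; apply: eq_integrable => // t _ /=.
by rewrite exprMn EFinM.
Qed.

Lemma L2_bounded u M : measurable_fun D u -> (forall t, D t -> `|u t| <= M) ->
  L2 T u.
Proof.
move=> mu_ uM; apply/L2P; split => //.
apply: measurable_bounded_integrable => //.
- exact: finite_mu_itv.
- by apply: measurable_funX.
- exists (M ^+ 2); split; first exact: num_real.
  move=> K MK t Dt /=; rewrite normrX (le_trans _ (ltW MK))// lerXn2r ?uM//.
  by rewrite nnegrE (le_trans _ (uM t Dt)).
Qed.

Lemma L2_cst a : L2 T (fun=> a).
Proof. by apply: (@L2_bounded _ `|a|). Qed.

Lemma L2_continuous u : {within `[0, T], continuous u} -> L2 T u.
Proof.
move=> cu; have cT := @segment_compact _ 0 T.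
have [M [_ HM]] := compact_bounded (continuous_compact cu cT).
apply: (@L2_bounded _ (M + 1)).
  apply: (@measurable_funS _ _ _ _ `[0, T]%classic) => //.
    exact: subset_itv_oo_cc.
  by apply: subspace_continuous_measurable_fun.
move=> t Dt; apply: (HM (M + 1)); first by rewrite ltrDl.
by exists t => //; exact: subset_itv_oo_cc.
Qed.

Lemma L2_integrable u : L2 T u -> mu.-integrable D (EFin \o u).
Proof.
move=> uL; have := L2_mul_integrable uL (L2_cst 1).
by apply: eq_integrable => // t _ /=; rewrite mulr1.
Qed.

Lemma Rintegral_lin2 a b u v w : L2 T u -> L2 T v -> L2 T w ->
  \int[mu]_(t in D) ((a * u t + b * v t) * w t) =
  a * \int[mu]_(t in D) (u t * w t) + b * \int[mu]_(t in D) (v t * w t).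
Proof.
move=> uL vL wL; have iu := L2_mul_integrable uL wL.
have iv := L2_mul_integrable vL wL; rewrite -!RintegralZl// -RintegralD//.
- by apply: eq_Rintegral => t _; rewrite mulrDl !mulrA.
- exact: (integrableZl mD a iu).
- exact: (integrableZl mD b iv).
Qed.

Lemma Rintegral_sum (I : finType) (F : I -> R -> R) :
  (forall i, mu.-integrable D (EFin \o F i)) ->
  \int[mu]_(t in D) (\sum_i F i t) = \sum_i \int[mu]_(t in D) F i t.
Proof.
move=> iF; elim: (index_enum I) => [|i s IH].
  rewrite big_nil; have := @Rintegral_cst _ _ _ mu D mD 0; rewrite mul0r => H; rewrite -[RHS]H.
  by apply: eq_Rintegral => t _; rewrite big_nil.
rewrite big_cons -IH -RintegralD//.
  by apply: eq_Rintegral => t _; rewrite big_cons.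
have := @integrable_sum _ _ _ mu D mD _ s xpredT (fun i => EFin \o F i).
by move=> /(_ (fun i _ => iF i)); apply: eq_integrable => // t _ /=; rewrite sumEFin.
Qed.

Lemma L2_sum (I : finType) (F : I -> R -> R) :
  (forall i, L2 T (F i)) -> L2 T (fun t => \sum_i F i t).
Proof.
move=> FL; elim: (index_enum I) => [|i s IH].
  by have := L2_cst 0; congr L2; apply/funext => t; rewrite big_nil.
have := L2D (FL i) IH; congr L2.
by apply/funext => t; rewrite big_cons.
Qed.

End scalar_L2.

Section vector_L2.
Context {R : realType} (T : R) {n : nat}.
Notation mu := (@lebesgue_measure R).
Notation D := (`]0, T[%classic : set R).
Implicit Types (x y z w : R -> 'cV[R]_n) (a : R).

Let mD : measurable (D : set (measurableTypeR R)).
Proof. exact: measurable_itv. Qed.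

Lemma ae_mono (P Q : R -> Prop) : (forall t, P t -> Q t) ->
  (\forall t \ae mu, P t) -> \forall t \ae mu, Q t.
Proof. exact: (@filterS _ _ (ae_filter_ringOfSetsType mu)). Qed.

Lemma ae_mono2 (P Q S : R -> Prop) : (forall t, P t -> Q t -> S t) ->
  (\forall t \ae mu, P t) -> (\forall t \ae mu, Q t) -> \forall t \ae mu, S t.
Proof. exact: (@filterS2 _ _ (ae_filter_ringOfSetsType mu)). Qed.

Lemma X_D x y : X T x -> X T y -> X T (x + y).
Proof.
move=> Xx Xy i; have := L2D (Xx i) (Xy i).
by congr L2; apply/funext => t; rewrite /coord !mxE.
Qed.

Lemma X_Z a x : X T x -> X T (a *: x).
Proof.
move=> Xx i; have := L2Z a (Xx i).
by congr L2; apply/funext => t; rewrite /coord !mxE.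
Qed.

Lemma X_0 : X T (0 : R -> 'cV[R]_n).
Proof.
move=> i; have := L2_cst T 0.
by congr L2; apply/funext => t; rewrite /coord !mxE.
Qed.

Lemma X_N x : X T x -> X T (- x).
Proof. by rewrite -scaleN1r; exact: X_Z. Qed.

Lemma X_B x y : X T x -> X T y -> X T (x - y).
Proof. by move=> Xx Xy; apply: X_D => //; exact: X_N. Qed.

Lemma X_sum (I : finType) (F : I -> R -> 'cV[R]_n) :
  (forall i, X T (F i)) -> X T (\sum_i F i).
Proof. by move=> XF; elim/big_ind : _ => //; [exact: X_0|exact: X_D]. Qed.

Lemma inner_integrable x y : X T x -> X T y ->
  mu.-integrable D (EFin \o (fun t => \sum_i coord i x t * coord i y t)).
Proof.
move=> Xx Xy; have := @integrable_sum _ _ _ mu D mD _ (index_enum 'I_n) xpredT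
  (fun i => EFin \o (fun t => coord i x t * coord i y t)).
move=> /(_ (fun i _ => L2_mul_integrable (Xx i) (Xy i))).
by apply: eq_integrable => // t _ /=; rewrite sumEFin.
Qed.

Lemma innerXC x y : innerX T x y = innerX T y x.
Proof.
by apply: eq_Rintegral => t _; apply: eq_bigr => i _; rewrite mulrC.
Qed.

Lemma innerXDl x y z : X T x -> X T y -> X T z ->
  innerX T (x + y) z = innerX T x z + innerX T y z.
Proof.
move=> Xx Xy Xz; rewrite /innerX -RintegralD//; try exact: inner_integrable.
apply: eq_Rintegral => t _; rewrite -big_split; apply: eq_bigr => i _.
by rewrite /coord !mxE mulrDl.
Qed.

Lemma innerXZl a x z : X T x -> X T z ->
  innerX T (a *: x) z = a * innerX T x z.
Proof.
move=> Xx Xz; rewrite /innerX -RintegralZl//; try exact: inner_integrable.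
apply: eq_Rintegral => t _; rewrite mulr_sumr; apply: eq_bigr => i _.
by rewrite /coord !mxE mulrA.
Qed.

Lemma innerX0l z : X T z -> innerX T 0 z = 0.
Proof.
by move=> Xz; rewrite -(scale0r 0) innerXZl ?mul0r//; exact: X_0.
Qed.

Lemma innerXBl x y z : X T x -> X T y -> X T z ->
  innerX T (x - y) z = innerX T x z - innerX T y z.
Proof.
move=> Xx Xy Xz; rewrite -scaleN1r innerXDl//; last exact: X_Z.
by rewrite innerXZl// mulN1r.
Qed.

Lemma innerX_sum x y : X T x -> X T y ->
  innerX T x y = \sum_i \int[mu]_(t in D) (coord i x t * coord i y t).
Proof.
move=> Xx Xy; rewrite -(@Rintegral_sum _ _ _ (fun i t => coord i x t * coord i y t))//.
by move=> i; exact: L2_mul_integrable.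
Qed.

Lemma innerX_suml (I : finType) (F : I -> R -> 'cV[R]_n) z :
  (forall i, X T (F i)) -> X T z ->
  innerX T (\sum_i F i) z = \sum_i innerX T (F i) z.
Proof.
move=> XF Xz; elim: (index_enum I) => [|i s IH].
  by rewrite !big_nil innerX0l.
rewrite !big_cons innerXDl ?IH//.
by elim/big_ind : _ => //; [exact: X_0|exact: X_D].
Qed.

Lemma innerX_ge0 x : 0 <= innerX T x x.
Proof.
by apply: Rintegral_ge0 => t _; apply: sumr_ge0 => i _; rewrite -expr2 sqr_ge0.
Qed.

Lemma normX_ge0 x : 0 <= normX T x.
Proof. exact: sqrtr_ge0. Qed.

Lemma sqr_normX x : normX T x ^+ 2 = innerX T x x.
Proof. by rewrite sqr_sqrtr// innerX_ge0. Qed.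

Lemma normXZ a x : X T x -> normX T (a *: x) = `|a| * normX T x.
Proof.
move=> Xx; rewrite /normX innerXZl//; last exact: X_Z.
rewrite innerXC innerXZl// mulrA -expr2 sqrtrM ?sqr_ge0// sqrtr_sqr//.
Qed.

Lemma normXN x : normX T (- x) = normX T x.
Proof.
congr Num.sqrt; apply: eq_Rintegral => t _; apply: eq_bigr => i _.
by rewrite /coord !mxE mulrNN.
Qed.

Lemma eqX_refl x : eqX T x x.
Proof. exact: ae_eq_refl. Qed.

Lemma eqX_sym x y : eqX T x y -> eqX T y x.
Proof. exact: ae_eq_sym. Qed.

Lemma eqX_trans y x z : eqX T x y -> eqX T y z -> eqX T x z.
Proof. exact: ae_eq_trans. Qed.

Lemma eqXD x x' y y' : eqX T x x' -> eqX T y y' -> eqX T (x + y) (x' + y').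
Proof.
apply: ae_mono2 => t ex ey Dt.
by rewrite [LHS]/(x t + y t) ex// ey.
Qed.

Lemma eqXZ a x x' : eqX T x x' -> eqX T (a *: x) (a *: x').
Proof.
apply: ae_mono => t ex Dt.
by rewrite [LHS]/(a *: x t) ex.
Qed.

Lemma eqXN x x' : eqX T x x' -> eqX T (- x) (- x').
Proof. by rewrite -(scaleN1r x) -(scaleN1r x'); exact: eqXZ. Qed.

Lemma eqXB x x' y y' : eqX T x x' -> eqX T y y' -> eqX T (x - y) (x' - y').
Proof. by move=> xx' yy'; apply: eqXD => //; exact: eqXN. Qed.

Lemma eqX_subr0 x y : eqX T (x - y) 0 <-> eqX T x y.
Proof.
split => [/eqXD/(_ (eqX_refl y))|/eqXB/(_ (eqX_refl y))].
  by rewrite subrK add0r.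
by rewrite subrr.
Qed.

Lemma innerX_eqX x x' y : X T x -> X T x' -> X T y -> eqX T x x' ->
  innerX T x y = innerX T x' y.
Proof.
move=> Xx Xx' Xy xx'; congr fine; apply: ae_eq_integral => //.
- exact: (measurable_int mu (inner_integrable Xx Xy)).
- exact: (measurable_int mu (inner_integrable Xx' Xy)).
by move: xx'; apply: ae_mono => t E Dt; rewrite /coord E.
Qed.

Lemma normX_eqX x x' : X T x -> X T x' -> eqX T x x' -> normX T x = normX T x'.
Proof.
move=> Xx Xx' xx'; rewrite /normX (innerX_eqX _ _ _ xx')// innerXC.
by rewrite (innerX_eqX _ _ _ xx').
Qed.

Lemma normX_eq0 x : X T x -> normX T x = 0 -> eqX T x 0.
Proof.
move=> Xx n0; have I0 : innerX T x x = 0 by rewrite -sqr_normX n0 expr0n.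
have ix := inner_integrable Xx Xx.
have ge0 t : 0 <= \sum_i coord i x t * coord i x t.
  by apply: sumr_ge0 => i _; rewrite -expr2 sqr_ge0.
pose q (t : R) := \sum_i coord i x t * coord i x t.
have : (\int[mu]_(t in D) `|(EFin \o q) t| = 0)%E.
  under eq_integral do rewrite /= ger0_norm ?ge0//.
  rewrite -[LHS]fineK; first by congr EFin.
  exact: integrable_fin_num.
move/(ae_eq_integral_abs mu mD (measurable_int mu ix)).
apply: ae_mono => t /[apply] -[] /eqP.
rewrite psumr_eq0 => [/allP {}x0|i _]; last by rewrite -expr2 sqr_ge0.
apply/matrixP => i j; rewrite (ord1 j) mxE; apply/eqP.
by have := x0 i; rewrite mem_index_enum => /(_ isT); rewrite -expr2 sqrf_eq0.
Qed.

Lemma normX_gt0 x : X T x -> nonzero T x -> 0 < normX T x.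
Proof.
move=> Xx nz; rewrite lt0r normX_ge0 andbT; apply/eqP => x0; apply: nz.
exact: normX_eq0.
Qed.

Lemma normX_0 : normX T (0 : R -> 'cV[R]_n) = 0.
Proof. by rewrite -(scale0r 0) normXZ ?normr0 ?mul0r//; exact: X_0. Qed.

Lemma innerX_le_norm x y : X T x -> X T y ->
  innerX T x y <= normX T x * normX T y.
Proof.
move=> Xx Xy; set a := normX T x; set b := normX T y.
have X0 := X_0.
have [a0|a0] := eqVneq a 0.
  by rewrite a0 mul0r (innerX_eqX Xx X0 Xy (normX_eq0 Xx a0)) innerX0l.
have [b0|b0] := eqVneq b 0.
  by rewrite b0 mulr0 innerXC (innerX_eqX Xy X0 Xx (normX_eq0 Xy b0)) innerX0l.
have ab : 0 < a * b by rewrite lt0r mulf_neq0//= mulr_ge0// normX_ge0.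
have Xbx := X_Z b Xx; have Xay := X_Z a Xy.
have := innerX_ge0 (b *: x - a *: y); have Xd := X_B Xbx Xay.
rewrite innerXBl// !innerXZl// ![innerX T _ (b *: x - _)]innerXC.
rewrite !innerXBl// !innerXZl// -!sqr_normX -/a -/b (innerXC y x).
rewrite [X in 0 <= X](_ : _ = 2 * ((a * b) * (a * b - innerX T x y))); last by ring.
by rewrite pmulr_rge0// pmulr_rge0// subr_ge0.
Qed.

Lemma normXD x y : X T x -> X T y -> normX T (x + y) <= normX T x + normX T y.
Proof.
move=> Xx Xy; rewrite -(@ler_pXn2r _ 2) ?nnegrE ?addr_ge0 ?normX_ge0//.
have Xd := X_D Xx Xy; rewrite sqrrD !sqr_normX innerXDl//.
rewrite ![innerX T _ (x + y)]innerXC !innerXDl// (innerXC y x).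
by have := innerX_le_norm Xx Xy; lra.
Qed.

End vector_L2.

(** * Density of polynomials *)

Section weierstrass.
Context {R : realType}.
Implicit Types (g h : nat -> R) (x a : R).

(** Bernstein polynomials, by de Casteljau's recursion: on x in [0, 1],
    bernstein m g x is the mean of g for the binomial law of parameters m, x. *)
Fixpoint bernstein m g : {poly R} :=
  if m is m'.+1 then 'X * bernstein m' (fun k => g k.+1) + (1 - 'X) * bernstein m' g
  else (g 0%N)%:P.

Lemma hornerE_bernstein m g x : (bernstein m.+1 g).[x] =
  x * (bernstein m (fun k => g k.+1)).[x] + (1 - x) * (bernstein m g).[x].
Proof. by rewrite /= !hornerE. Qed.

Lemma bernstein_le m g h x : 0 <= x <= 1 -> (forall k, (k <= m)%N -> g k <= h k) ->
  (bernstein m g).[x] <= (bernstein m h).[x].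
Proof.
move=> /andP[x0 x1]; elim: m g h => [|m IH] g h gh; first by rewrite !hornerE gh.
rewrite !hornerE_bernstein lerD// ler_wpM2l ?subr_ge0//; apply: IH => k km.
  exact: gh.
by apply: gh; exact: ltnW.
Qed.

Lemma bernsteinD m g h x :
  (bernstein m (fun k => g k + h k)).[x] = (bernstein m g).[x] + (bernstein m h).[x].
Proof.
elim: m g h => [|m IH] g h; first by rewrite /= polyCD !hornerE.
by rewrite !hornerE_bernstein (IH (fun k => g k.+1)) IH; ring.
Qed.

Lemma bernsteinZ m a g x :
  (bernstein m (fun k => a * g k)).[x] = a * (bernstein m g).[x].
Proof.
elim: m g => [|m IH] g; first by rewrite /= !hornerE.
by rewrite !hornerE_bernstein (IH (fun k => g k.+1)) IH; ring.
Qed.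

Lemma bernstein_cst m a x : (bernstein m (fun=> a)).[x] = a.
Proof. by elim: m => [|m IH]; rewrite ?hornerE_bernstein ?IH /= ?hornerE//; ring. Qed.

(** The second moment about a of the binomial law of parameters m, x. *)
Lemma bernstein_variance m a x :
  (bernstein m (fun k => (k%:R - a) ^+ 2)).[x] = (m%:R * x - a) ^+ 2 + m%:R * x * (1 - x).
Proof.
elim: m a => [|m IH] a; first by rewrite /= !hornerE; ring.
rewrite hornerE_bernstein.
have -> : (fun k : nat => (k.+1%:R - a) ^+ 2) = fun k => (k%:R - (a - 1)) ^+ 2.
  by apply/funext => k; rewrite -natr1; congr (_ ^+ 2); ring.
by rewrite !IH -natr1; ring.
Qed.

Lemma segment_uniform_continuous (f : R -> R) (a b eps : R) : continuous f -> 0 < eps ->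
  exists2 d, 0 < d & forall x y, a <= x <= b -> `|x - y| <= d -> `|f x - f y| <= eps.
Proof.
move=> cf e0.
have := proj1 (compact_near_coveringP _) (@segment_compact R a b) R (0 : R)^'+
  (fun d x => forall y, `|x - y| <= d -> `|f x - f y| <= eps) _.
case=> [x _|d /= d0 Hd].
  have e2 : 0 < eps / 2 by rewrite divr_gt0.
  have /cvgrPdist_le/(_ _ e2)/nbhs_ballP[d /= d0 Hd] := cf x.
  have d2 : 0 < d / 2 by rewrite divr_gt0.
  exists (ball x (d / 2), [set i | i < d / 2]).
    by split; [exact: nbhsx_ballx|exact: nbhs_right_lt].
  move=> [z i] /= [xz id] y zy; rewrite /ball/= in xz.
  have fz : `|f x - f z| <= eps / 2.
    by apply: Hd; rewrite /ball/= (lt_trans xz)// ltr_pdivrMr// ltr_pMr// ltr1n.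
  have fy : `|f x - f y| <= eps / 2.
    apply: Hd; rewrite /ball/= (le_lt_trans (ler_distD z _ _))//.
    by rewrite [ltRHS](splitr d) ltrD// (le_lt_trans zy).
  rewrite (le_trans (ler_distD (f x) _ _))// (splitr eps) lerD//.
  by rewrite distrC.
have d2 : 0 < d / 2 by rewrite divr_gt0.
exists (d / 2) => // x y xab xy; apply: (Hd (d / 2)) => //.
by rewrite /= sub0r normrN gtr0_norm// ltr_pdivrMr// ltr_pMr// ltr1n.
Qed.

(** A continuous f satisfies |f x - f y| <= eps / 2 + C (x - y)^2, so the error
    of its Bernstein polynomial is controlled by the variance of the binomial
    law. *)
Lemma weierstrass (u : R -> R) (T eps : R) : continuous u -> 0 < T -> 0 < eps ->
  exists p : {poly R}, forall t, 0 <= t <= T -> `|u t - p.[t]| <= eps.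
Proof.
move=> cu T0 e0; have e2 : 0 < eps / 2 by rewrite divr_gt0.
have [d d0 ud] := segment_uniform_continuous 0 T cu e2.
have cu' : {within `[0, T], continuous u} by exact: continuous_subspaceT.
have [M [_ HM]] := compact_bounded (continuous_compact cu' (@segment_compact _ 0 T)).
pose B := `|M| + 1.
have uB t : 0 <= t <= T -> `|u t| <= B.
  move=> t0T; apply: (HM B); first by rewrite ltr_pwDr// ler_norm.
  by exists t.
have B0 : 0 <= B by rewrite addr_ge0.
pose C := 2 * B / d ^+ 2.
have C0 : 0 <= C by rewrite divr_ge0 ?sqr_ge0// mulr_ge0.
have uC x y : 0 <= x <= T -> 0 <= y <= T -> `|u x - u y| <= eps / 2 + C * (x - y) ^+ 2.
  move=> xT yT; have [xy|xy] := leP `|x - y| d.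
    by rewrite (le_trans (ud _ _ xT xy))// lerDl mulr_ge0// sqr_ge0.
  apply: (@le_trans _ _ (B + B)).
    by rewrite (le_trans (ler_normB _ _))// lerD// uB.
  apply: (@le_trans _ _ (C * (x - y) ^+ 2)); last by rewrite lerDr ltW.
  have q1 : 1 <= (x - y) ^+ 2 / d ^+ 2.
    rewrite ler_pdivlMr ?exprn_gt0// mul1r -[leRHS]real_normK ?num_real//.
    by rewrite lerXn2r ?nnegrE ?(ltW d0)// ltW.
  rewrite [leRHS](_ : _ = (B + B) * ((x - y) ^+ 2 / d ^+ 2)); last first.
    by rewrite /C; ring.
  by rewrite ler_peMr// addr_ge0.
have [N N1 HN] : exists2 N : nat, (0 < N)%N & C * T ^+ 2 / N%:R <= eps / 2.
  exists (Num.truncn (C * T ^+ 2 / (eps / 2))).+1 => //.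
  rewrite ler_pdivrMr// [leRHS]mulrC -ler_pdivrMr// ltW//.
  by rewrite truncnS_gt.
pose g k := u (T * k%:R / N%:R).
have N0 : 0 < N%:R :> R by rewrite ltr0n.
exists (bernstein N g \Po (T^-1 *: 'X)) => t tT.
pose s := T^-1 * t; have ts : t = T * s by rewrite /s mulrA divff ?mul1r// gt_eqF.
have s01 : 0 <= s <= 1.
  case/andP: tT => t0 tT; apply/andP; split.
    by rewrite mulr_ge0// invr_ge0 ltW.
  by rewrite /s mulrC ler_pdivrMr// mul1r.
rewrite horner_comp !hornerE -/s.
pose h k := eps / 2 + C * T ^+ 2 / N%:R ^+ 2 * (k%:R - N%:R * s) ^+ 2.
have gh k : (k <= N)%N -> `|g k - u t| <= h k.
  move=> kN; rewrite (le_trans (uC _ _ _ _))//.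
    rewrite -mulrA mulr_ge0 ?(ltW T0) ?divr_ge0//=.
    by rewrite ler_piMr ?(ltW T0)// ler_pdivrMr// mul1r ler_nat.
  rewrite /h lerD2l ts le_eqVlt; apply/orP; left; apply/eqP.
  by field; rewrite gt_eqF.
have hE : (bernstein N h).[s] <= eps.
  rewrite bernsteinD bernstein_cst bernsteinZ bernstein_variance.
  rewrite subrr expr0n add0r {2}(splitr eps) lerD2l (le_trans _ HN)//.
  rewrite [leLHS](_ : _ = C * T ^+ 2 / N%:R * (s * (1 - s))); last first.
    by field; rewrite gt_eqF.
  apply: ler_piMr; first by rewrite divr_ge0// mulr_ge0// sqr_ge0.
  by case/andP: s01 => s0 s1; nra.
have BE : (bernstein N (fun k => g k + - u t)).[s] = (bernstein N g).[s] - u t.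
  by rewrite bernsteinD bernstein_cst.
rewrite distrC -BE ler_norml; apply/andP; split.
  rewrite lerNl (le_trans _ hE)// -mulN1r -bernsteinZ.
  apply: bernstein_le => // k /gh; rewrite ler_norml mulN1r => /andP[? _].
  by rewrite lerNl.
rewrite (le_trans _ hE)//.
by apply: bernstein_le => // k /gh; rewrite ler_norml => /andP[].
Qed.

End weierstrass.

Section density.
Context {R : realType} (T : R).
Hypothesis T0 : 0 < T.
Notation mu := (@lebesgue_measure R).
Notation D := (`]0, T[%classic : set R).
Implicit Types (u w : R -> R) (p : {poly R}).

Let mD : measurable (D : set (measurableTypeR R)).
Proof. exact: measurable_itv. Qed.

Lemma ecvg0_small (f : nat -> \bar R) (eps : R) : 0 < eps ->
  f @ \oo --> (0%E : \bar R) -> exists m, fine (f m) <= eps.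
Proof.
move=> e0 /fine_cvgP[_ /cvgrPdist_le/(_ _ e0)[m _ /(_ _ (leqnn m))]].
by rewrite /= sub0r normrN => fm; exists m; exact: le_trans (ler_norm _) fm.
Qed.

Lemma L2_horner p : L2 T (horner p).
Proof. by apply: L2_continuous; apply: continuous_subspaceT; exact: continuous_horner. Qed.

Lemma L2_sqr_integrable u : L2 T u -> mu.-integrable D (EFin \o (fun t => u t ^+ 2)).
Proof. by case/L2P. Qed.

Lemma L2N u : L2 T u -> L2 T (fun t => - u t).
Proof.
move=> /(L2Z (-1)); congr L2; by apply/funext => t; rewrite mulN1r.
Qed.

Lemma L2B u w : L2 T u -> L2 T w -> L2 T (fun t => u t - w t).
Proof. by move=> uL wL; apply: L2D => //; exact: L2N. Qed.

(** The triangle inequality in terms of squared distances: successive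
    approximations are chained without taking roots of their errors. *)
Lemma L2_dist_trans (u v w : R -> R) (e1 e2 : R) : L2 T u -> L2 T v -> L2 T w ->
  \int[mu]_(t in D) (u t - v t) ^+ 2 <= e1 ->
  \int[mu]_(t in D) (v t - w t) ^+ 2 <= e2 ->
  \int[mu]_(t in D) (u t - w t) ^+ 2 <= 2 * e1 + 2 * e2.
Proof.
move=> uL vL wL h1 h2.
have i1 := L2_sqr_integrable (L2B uL vL); have i2 := L2_sqr_integrable (L2B vL wL).
have i3 := L2_sqr_integrable (L2B uL wL).
have j1 := integrableZl mD 2 i1; have j2 := integrableZl mD 2 i2.
apply: (@le_trans _ _ (\int[mu]_(t in D) (2 * (u t - v t) ^+ 2 + 2 * (v t - w t) ^+ 2))).
  apply: le_Rintegral => //; first exact: (integrableD mD j1 j2).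
  by move=> t _; have := sqr_ge0 (u t - v t - (v t - w t)); nra.
rewrite (@RintegralD _ _ _ mu D (fun t => 2 * (u t - v t) ^+ 2)
  (fun t => 2 * (v t - w t) ^+ 2))//.
by rewrite !RintegralZl// lerD// ler_wpM2l.
Qed.

Lemma dist_clamp (b a M : R) : `|a| <= M ->
  `|a - Num.max (- M) (Num.min M b)| <= 2 * M /\
  `|a - Num.max (- M) (Num.min M b)| <= `|a - b|.
Proof.
rewrite ler_norml => /andP[al ar].
have h1 := ler_norm (a - b); have h2 := ler_norm (b - a); rewrite distrC in h2.
rewrite /Order.max /Order.min !ler_norml.
case: (ltP M b) => ?; case: ltP => ?; split; apply/andP; split; lra.
Qed.

(** A continuous approximation in L1 becomes one in L2 after clamping it to
    [-M, M], since then the squared error is at most 2 M times the error. *)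
Lemma poly_dense_bounded w (M eps : R) : measurable_fun D w ->
  (forall t, D t -> `|w t| <= M) -> 0 < eps ->
  exists p, \int[mu]_(t in D) (w t - p.[t]) ^+ 2 <= eps.
Proof.
move=> mw wM e0; have wL := L2_bounded mw wM.
have M0 : 0 <= M.
  apply: le_trans (wM (T / 2) _) => //=.
  by rewrite in_itv/= divr_gt0//= ltr_pdivrMr// ltr_pMr// ltr1n.
have iw := L2_integrable wL.
have [g [cg ig]] := approximation_continuous_integrable mD (finite_mu_itv T) iw.
pose K := 8 * M + 1; have K0 : 0 < K by rewrite ltr_wpDl// mulr_ge0.
have eK : 0 < eps / 2 / K by rewrite !divr_gt0.
move=> /(ecvg0_small eK)[m Hm].
pose c t := Num.max (- M) (Num.min M (g m t)).
have cc : continuous c.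
  move=> t; apply: (@continuous_max R _ (cst (- M)) (fun t => Num.min M (g m t))).
    exact: cst_continuous.
  apply: (@continuous_min R _ (cst M) (g m)); [exact: cst_continuous|exact: cg].
have cL : L2 T c by apply: L2_continuous; exact: continuous_subspaceT.
have iwg : mu.-integrable D (EFin \o (fun t => `|w t - g m t|)).
  by apply: integrable_norm; exact: (integrableB mD iw (ig m)).
have wc : \int[mu]_(t in D) (w t - c t) ^+ 2 <= eps / 8.
  apply: (@le_trans _ _ (\int[mu]_(t in D) (2 * M * `|w t - g m t|))).
    apply: le_Rintegral => //.
    - exact: L2_sqr_integrable (L2B wL cL).
    - exact: (integrableZl mD (2 * M) iwg).
    move=> t /wM /(dist_clamp (g m t))[c1 c2].
    by rewrite -real_normK ?num_real// expr2; apply: ler_pM.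
  rewrite RintegralZl//.
  have {Hm} : \int[mu]_(t in D) `|w t - g m t| <= eps / 2 / K by exact: Hm.
  move=> Hm; apply: (le_trans (ler_wpM2l _ Hm)); first by rewrite mulr_ge0.
  rewrite mulrA ler_pdivrMr// /K; nra.
pose eta := Num.sqrt (eps / 8 / T).
have eta0 : 0 < eta by rewrite sqrtr_gt0 !divr_gt0.
have [p Hp] := weierstrass cc T0 eta0.
have cp : \int[mu]_(t in D) (c t - p.[t]) ^+ 2 <= eps / 8.
  apply: (@le_trans _ _ (\int[mu]_(t in D) (eps / 8 / T))).
    apply: le_Rintegral => //.
    - exact: L2_sqr_integrable (L2B cL (L2_horner p)).
    - exact: L2_integrable (L2_cst T _).
    move=> t /= /[!in_itv]/= /andP[t0 tT].
    have /(_ _)/wrap[] := Hp t; rewrite ?(ltW t0) ?(ltW tT)// => cpt.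
    rewrite -real_normK ?num_real// -[leRHS]sqr_sqrtr; last by rewrite !divr_ge0// ltW.
    by rewrite lerXn2r ?nnegrE// ltW.
  rewrite Rintegral_cst//= lebesgue_measure_itv/= lte_fin T0 /= oppr0 addr0.
  by rewrite divfK// gt_eqF.
exists p; apply: le_trans (L2_dist_trans wL cL (L2_horner p) wc cp) _.
lra.
Qed.

(** Prescribing a zero of order B at an endpoint e does not destroy density:
    u / (t - e)^B is truncated to a bounded function before it is approximated. *)
Lemma poly_dense_weighted u (e : R) (B : nat) (eps : R) : L2 T u ->
  (forall t, D t -> t != e /\ `|t - e| <= T) -> 0 < eps ->
  exists p, \int[mu]_(t in D) (u t - (t - e) ^+ B * p.[t]) ^+ 2 <= eps.
Proof.
move=> uL De e0; have mu_ := L2_measurable uL.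
pose q : {poly R} := ('X - e%:P) ^+ B.
have qE t : q.[t] = (t - e) ^+ B by rewrite /q !hornerE.
have mq : measurable_fun D (horner q) by exact: L2_measurable (L2_horner q).
have q0 t : D t -> q.[t] != 0 by move=> /De[te _]; rewrite qE expf_neq0// subr_eq0.
pose w t := u t * (q.[t])^-1.
have mw : measurable_fun D w.
  apply: measurable_funM => //; apply: subspace_continuous_measurable_fun => //.
  apply: continuous_in_subspaceT => t; rewrite inE => Dt.
  by apply: cvgV; [exact: q0|exact: continuous_horner].
pose wm m t := if `|w t| <= m%:R then w t else 0.
have mwm m : measurable_fun D (wm m).
  apply: measurable_fun_if => //; last first.
    by apply: measurable_funS mw => //; exact: subIsetl.
  apply: measurable_fun_ler => //.
  exact: measurableT_comp.
have wmM m t : D t -> `|wm m t| <= m%:R.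
  by rewrite /wm; case: ifP => // _ _; rewrite normr0.
have wmL m : L2 T (wm m) by exact: L2_bounded (mwm m) (wmM m).
have qT t : D t -> q.[t] ^+ 2 <= T ^+ (B * 2).
  move=> /De[_ tT]; rewrite qE -real_normK ?num_real// normrX -exprM.
  by rewrite lerXn2r ?nnegrE// ltW.
have qL v : L2 T v -> L2 T (fun t => q.[t] * v t).
  move=> vL; apply/L2P; split; first by apply: measurable_funM => //; exact: L2_measurable.
  have := integrableZl mD (T ^+ (B * 2)) (L2_sqr_integrable vL).
  apply: le_integrable => //.
    apply/measurable_EFinP; apply: measurable_funX; apply: measurable_funM => //.
    exact: L2_measurable.
  move=> t Dt /=; rewrite lee_fin !ger0_norm ?sqr_ge0//; last first.
    by rewrite mulr_ge0 ?sqr_ge0// exprn_ge0// ltW.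
  by rewrite exprMn ler_wpM2r ?sqr_ge0// qT.
have [m Hm] : exists m, \int[mu]_(t in D) (u t - q.[t] * wm m t) ^+ 2 <= eps / 4.
  have e4 : 0 < eps / 4 by rewrite divr_gt0.
  pose f_ m t : \bar R := ((u t - q.[t] * wm m t) ^+ 2)%:E.
  have [] := @dominated_convergence _ _ _ mu D mD f_ (cst 0%E)
      (EFin \o (fun t => u t ^+ 2)).
  - move=> m; exact: (measurable_int mu (L2_sqr_integrable (L2B uL (qL _ (wmL m))))).
  - by [].
  - apply: aeW => t Dt; apply: cvg_near_cst.
    exists (Num.truncn `|w t|).+1 => // m /= wtm.
    rewrite /f_ /wm ifT; last first.
      by rewrite ltW// (lt_le_trans (truncnS_gt _))// ler_nat.
    by rewrite /w mulrCA divff ?q0// mulr1 subrr expr0n.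
  - exact: L2_sqr_integrable.
  - apply: aeW => t m Dt; rewrite /f_ /wm /= lee_fin ger0_norm ?sqr_ge0//.
    case: ifP => _; last by rewrite mulr0 subr0.
    by rewrite /w mulrCA divff ?q0// mulr1 subrr expr0n sqr_ge0.
  move=> _ _; rewrite integral0 => /(ecvg0_small e4)[m Hm].
  by exists m.
have T2 : 0 < T ^+ (B * 2) by rewrite exprn_gt0.
have eT : 0 < eps / 4 / T ^+ (B * 2) by rewrite !divr_gt0.
have [p Hp] := poly_dense_bounded (mwm m) (wmM m) eT.
have dL := L2B (wmL m) (L2_horner p).
have Hq : \int[mu]_(t in D) (q.[t] * wm m t - q.[t] * p.[t]) ^+ 2 <= eps / 4.
  apply: (@le_trans _ _ (\int[mu]_(t in D) (T ^+ (B * 2) * (wm m t - p.[t]) ^+ 2))).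
    apply: le_Rintegral => //.
    - exact: (L2_sqr_integrable (L2B (qL _ (wmL m)) (qL _ (L2_horner p)))).
    - exact: (integrableZl mD _ (L2_sqr_integrable dL)).
    by move=> t Dt; rewrite -mulrBr exprMn ler_wpM2r ?sqr_ge0// qT.
  rewrite RintegralZl//; last exact: (L2_sqr_integrable dL).
  by rewrite mulrC -ler_pdivlMr.
exists p; under eq_Rintegral do rewrite -qE.
apply: le_trans (L2_dist_trans uL (qL _ (wmL m)) (qL _ (L2_horner p)) Hm Hq) _.
lra.
Qed.

End density.

(** * Weak derivatives *)

Section weak_derivative.
Context {R : realType} (T : R).
Hypothesis T0 : 0 < T.
Notation mu := (@lebesgue_measure R).
Notation D := (`]0, T[%classic : set R).
Implicit Types (u v g h phi : R -> R) (p : {poly R}) (a : R).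

Let mD : measurable (D : set (measurableTypeR R)).
Proof. exact: measurable_itv. Qed.

Lemma Rintegral_derive (F f : R -> R) (a b : R) : a < b ->
  (forall t : R, is_derive t (1 : R) F (f t)) -> continuous f ->
  \int[mu]_(t in `]a, b[) f t = F b - F a.
Proof.
move=> ab dF cf.
have cF : continuous F.
  move=> t; apply/differentiable_continuous/derivable1_diffP.
  by have [] := dF t.
have := @continuous_FTC2 R f F a b ab.
move=> /(_ (continuous_subspaceT cf)) H.
rewrite /Rintegral -(@integral_itv_bndoo _ a b _ true false)/=.
  rewrite (_ : \int[mu]_(x in `[a, b]) (f x)%:E = (F b)%:E - (F a)%:E)%E//.
  apply: H.
    split.
    - by move=> t _; have [] := dF t.
    - exact/cvg_at_right_filter/cF.
    - exact/cvg_at_left_filter/cF.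
  by move=> t _; rewrite derive1E; have [_ ->] := dF t.
apply/measurable_EFinP; apply: measurable_funTS.
exact: continuous_measurable_fun.
Qed.

Lemma test_is_derive phi : test_function T phi ->
  forall t : R, is_derive t (1 : R) phi (derive1 phi t).
Proof.
case=> /(_ 0%N) dphi _ _ t; apply: DeriveDef; first exact: dphi.
by rewrite derive1E.
Qed.

Lemma test_continuous phi : test_function T phi -> continuous phi.
Proof.
case=> /(_ 0%N) dphi _ _ t; apply/differentiable_continuous/derivable1_diffP.
exact: dphi.
Qed.

Lemma test_derive_continuous phi : test_function T phi -> continuous (derive1 phi).
Proof.
case=> /(_ 1%N) dphi _ _ t; apply/differentiable_continuous/derivable1_diffP.
exact: dphi.
Qed.

Lemma test_out phi t : test_function T phi -> ~ D t -> phi t = 0.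
Proof.
case=> _ _ sub nt; apply/eqP/negPn/negP => nz; apply: nt; apply: sub.
by apply: subset_closure.
Qed.

Lemma L2_of_continuous u : continuous u -> L2 T u.
Proof. by move=> cu; apply: L2_continuous; exact: continuous_subspaceT. Qed.

Lemma eq_weak_derivative u g v h : is_weak_derivative T u g ->
  (forall t, D t -> u t = v t) -> (forall t, D t -> g t = h t) ->
  is_weak_derivative T v h.
Proof.
move=> ug uv gh phi tphi; have := ug phi tphi.
rewrite (@eq_Rintegral _ _ _ mu D (fun t => v t * derive1 phi t)); last first.
  by move=> t; rewrite inE => Dt; rewrite uv.
move=> ->; congr (- _); apply: eq_Rintegral => t.
by rewrite inE => Dt; rewrite gh.
Qed.

Lemma weak_derivative_lin a u v g h : L2 T u -> L2 T v -> L2 T g -> L2 T h ->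
  is_weak_derivative T u g -> is_weak_derivative T v h ->
  is_weak_derivative T (fun t => a * u t + v t) (fun t => a * g t + h t).
Proof.
move=> uL vL gL hL ug vh phi tphi.
have pL := L2_of_continuous (test_continuous tphi).
have dL := L2_of_continuous (test_derive_continuous tphi).
have lin u1 v1 w : L2 T u1 -> L2 T v1 -> L2 T w ->
    \int[mu]_(t in D) ((a * u1 t + v1 t) * w t) =
    a * \int[mu]_(t in D) (u1 t * w t) + \int[mu]_(t in D) (v1 t * w t).
  move=> u1L v1L wL; rewrite -[X in _ + X]mul1r -Rintegral_lin2//.
  by apply: eq_Rintegral => t _; rewrite mul1r.
by rewrite !lin// ug// vh// mulrN opprD.
Qed.

Definition ramp p a (t : R) : R := if a < t then p.[t] else 0.

Lemma ramp_L2 p a : L2 T (ramp p a).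
Proof.
have pL := L2_horner T p; have mp := L2_measurable pL.
apply/L2P; split.
  apply: (@measurable_fun_if _ _ (measurableTypeR R) R (horner p) (cst 0) D mD (fun t => a < t)).
  - by apply: measurable_fun_ltr.
  - by apply: measurable_funS mp => //; exact: subIsetl.
  - exact: measurable_cst.
have := L2_sqr_integrable pL; apply: le_integrable => //.
  apply/measurable_EFinP/measurable_funX.
  apply: (@measurable_fun_if _ _ (measurableTypeR R) R (horner p) (cst 0) D mD (fun t => a < t)).
  - by apply: measurable_fun_ltr.
  - by apply: measurable_funS mp => //; exact: subIsetl.
  - exact: measurable_cst.
move=> t _ /=; rewrite lee_fin /ramp; case: ifP => // _.
by rewrite expr0n normr0.
Qed.

(** The truncated polynomial has no jump inside (0, T), because the cut lies to the
    left of the interval or at a zero of p. *)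
Lemma weak_derivative_ramp p a : a <= 0 \/ p.[a] = 0 ->
  is_weak_derivative T (ramp p a) (ramp (deriv p) a).
Proof.
move=> pa phi tphi; pose c := Num.max 0 a.
have DaE : D `&` [set t | a < t] = `]c, T[%classic.
  apply/seteqP; split => t /=; rewrite !in_itv/= gt_max.
    by move=> [/andP[-> ->] ->].
  by move=> /andP[/andP[-> ->] ->].
have restr q psi : \int[mu]_(t in D) (ramp q a t * psi t) =
    \int[mu]_(t in `]c, T[) (q.[t] * psi t).
  rewrite -DaE Rintegral_mkcondr; apply: eq_Rintegral => t _.
  rewrite /patch /ramp; have [at_|at_] := ltP a t.
    by rewrite mem_set.
  by rewrite memNset ?mul0r//=; apply/negP; rewrite -leNgt.
rewrite !restr; have [Tc|cT] := leP T c.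
  by rewrite set_itv_ge ?bnd_simp -?leNgt// !Rintegral_set0 oppr0.
have sub : `]c, T[ `<=` D.
  by move=> t /=; rewrite !in_itv/= gt_max => /andP[/andP[-> _] ->].
have cphi := test_continuous tphi; have cdphi := test_derive_continuous tphi.
have cp q := @continuous_horner R q.
have i1 : mu.-integrable `]c, T[ (EFin \o (fun t => p.[t] * derive1 phi t)).
  apply: integrableS (L2_mul_integrable (L2_horner T p) (L2_of_continuous cdphi)) => //.
have i2 : mu.-integrable `]c, T[ (EFin \o (fun t => phi t * (deriv p).[t])).
  apply: integrableS (L2_mul_integrable (L2_of_continuous cphi) (L2_horner T _)) => //.
have FTC := @Rintegral_derive (fun t => p.[t] * phi t)
  (fun t => p.[t] * derive1 phi t + phi t * (deriv p).[t]) c T cT.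
have {FTC} : \int[mu]_(t in `]c, T[) (p.[t] * derive1 phi t + phi t * (deriv p).[t])
    = p.[T] * phi T - p.[c] * phi c.
  apply: FTC => [t|t].
    exact: (is_deriveM (is_derive_poly p t) (test_is_derive tphi t)).
  by apply: cvgD; apply: cvgM; [exact: cp|exact: cdphi|exact: cphi|exact: cp].
have -> : phi T = 0 by apply: test_out tphi _; rewrite /= in_itv/= ltxx andbF.
have -> : p.[c] * phi c = 0.
  rewrite /c; have [a0|a0] := leP a 0.
    by rewrite (test_out tphi) ?mulr0//= in_itv/= ltxx.
  by case: pa => [|->]; [rewrite leNgt a0|rewrite mul0r].
rewrite mulr0 subr0 RintegralD// => /eqP; rewrite addr_eq0 => /eqP ->.
by congr (- _); apply: eq_Rintegral => t _; rewrite mulrC.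
Qed.

Lemma weak_derivative_horner p : is_weak_derivative T (horner p) (horner (deriv p)).
Proof.
apply: (eq_weak_derivative (@weak_derivative_ramp p 0 (or_introl (lexx _)))) => t;
by rewrite /= in_itv/= => /andP[t0 _]; rewrite /ramp t0.
Qed.

Lemma H1_lin a u v : H1 T u -> H1 T v -> H1 T (fun t => a * u t + v t).
Proof.
move=> [uL cu [g [gL ug]]] [vL cv [h [hL vh]]]; split.
- by apply: L2D => //; exact: L2Z.
- by move=> t; apply: cvgD; [apply: cvgM; [exact: cvg_cst|exact: cu]|exact: cv].
- exists (fun t => a * g t + h t); split; first by apply: L2D => //; exact: L2Z.
  exact: weak_derivative_lin.
Qed.

Lemma H1_horner p : H1 T (horner p).
Proof.
have cp := @continuous_horner R p; split.
- exact: L2_of_continuous.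
- exact: continuous_subspaceT.
- exists (horner (deriv p)); split; first exact: L2_horner.
  exact: weak_derivative_horner.
Qed.

Lemma H1_0 : H1 T (fun=> 0).
Proof. by have := H1_horner 0; congr H1; apply/funext => t; rewrite horner0. Qed.

Lemma H1_Z a u : H1 T u -> H1 T (fun t => a * u t).
Proof.
move=> uH; have := H1_lin a uH H1_0; congr H1.
by apply/funext => t; rewrite addr0.
Qed.

Lemma H1_ramp a : H1 T (ramp ('X - a%:P) a).
Proof.
have rE : ramp ('X - a%:P) a = fun t => Num.max 0 (t - a).
  apply/funext => t; rewrite /ramp !hornerE; have [at_|ta] := ltP a t.
    by rewrite max_r// subr_ge0 ltW.
  by rewrite max_l// subr_le0.
split; first exact: ramp_L2.
- apply: continuous_subspaceT; rewrite rE => t.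
  apply: (@continuous_max R _ (cst 0) (fun t => t - a)); first exact: cst_continuous.
  by apply: cvgD; [exact: cvg_id|exact: cvg_cst].
- exists (ramp (deriv ('X - a%:P)) a); split; first exact: ramp_L2.
  by apply: weak_derivative_ramp; right; rewrite !hornerE subrr.
Qed.

(** A hat function is a second difference of ramps. *)
Lemma H1_hat K k : (0 < K)%N -> H1 T (hat T K k).
Proof.
move=> K0; pose d := T / K%:R; have d0 : 0 < d by rewrite divr_gt0 ?ltr0n.
have := H1_lin d^-1 (H1_ramp (k%:R * d + 1 * d))
  (H1_lin (- (2 / d)) (H1_ramp (k%:R * d + 0 * d))
    (H1_Z d^-1 (H1_ramp (k%:R * d + (-1) * d)))).
congr H1; apply/funext => t; rewrite /hat -/d.
pose z := (t - k%:R * d) / d; have -> : t = k%:R * d + z * d.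
  by rewrite /z divfK ?gt_eqF//; ring.
have rampE j : ramp ('X - (k%:R * d + j * d)%:P) (k%:R * d + j * d) (k%:R * d + z * d)
    = d * Num.max 0 (z - j).
  rewrite /ramp ltrD2l ltr_pM2r// hornerXsubC /Order.max subr_gt0.
  by case: ifP => _; ring.
have two m : - (2 / d) * (d * m) = - (2 * m) by field; rewrite gt_eqF.
rewrite !rampE two !mulKf ?gt_eqF//.
rewrite [_ + z * d - _](_ : _ = z * d); last by ring.
rewrite normrM (gtr0_norm d0) mulfK ?gt_eqF// /Order.max.
case: (ltrP z 0) => z0; rewrite ?(ltr0_norm z0) ?(ger0_norm z0);
by case: ltrP => ?; case: ltrP => ?; case: ltrP => ?; case: ltrP => ?; lra.
Qed.

End weak_derivative.

(** * Integration by parts against polynomials *)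

Section integration_by_parts.
Context {R : realType} (T : R).
Hypothesis T0 : 0 < T.
Notation mu := (@lebesgue_measure R).
Notation D := (`]0, T[%classic : set R).
Implicit Types (u v g h phi : R -> R) (p : {poly R}) (a : R).

Let mD : measurable (D : set (measurableTypeR R)).
Proof. exact: measurable_itv. Qed.

Lemma step_derive : exists S' : R -> R, [/\ smooth S',
  forall t : R, is_derive t (1 : R) step (S' t),
  forall t, ~~ (0 <= t <= 1) -> S' t = 0 &
  exists2 M, 0 <= M & forall t, `|S' t| <= M].
Proof.
have [S' sS' dS] := smooth_is_derive (@smooth_step R).
have S'0 t : ~~ (0 <= t <= 1) -> S' t = 0.
  have cst0 (c : R) : (\forall s \near t, c = step s) -> S' t = 0.
    move=> near_c; have [_ <-] := dS t.
    have H := @near_eq_is_derive _ R R (cst c) step t 1 0 near_c.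
    by have [_ ->] := H (is_derive_cst _ _ _).
  rewrite negb_and -!ltNge => /orP[t0|t1].
    apply: (cst0 0); near=> s; rewrite step_eq0// ltW//; near: s; exact: lt_nbhsl.
  apply: (cst0 1); near=> s; rewrite step_eq1// ltW//; near: s; exact: lt_nbhsr.
exists S'; split => //.
have cS : {within `[0, 1], continuous S'}.
  exact: continuous_subspaceT (smooth_continuous sS').
have [M [_ HM]] := compact_bounded (continuous_compact cS (@segment_compact _ 0 1)).
exists (`|M| + 1) => [|t]; first by rewrite addr_ge0.
have [t01|t01] := boolP (0 <= t <= 1); last by rewrite S'0// normr0 addr_ge0.
by apply: (HM (`|M| + 1)); [rewrite ltr_pwDr// ler_norm|exists t].
Unshelve. all: by end_near. Qed.

(** The rescaled derivative of the step is an approximate identity: it has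
    integral 1, is bounded by M / e and supported in an interval of length e.
    That interval lies inside (0, T) but only close to c, so that c may be an
    endpoint. *)
Lemma approximate_identity (S' U : R -> R) (c eta : R) : continuous S' ->
  (forall t : R, is_derive t (1 : R) step (S' t)) ->
  (forall t, ~~ (0 <= t <= 1) -> S' t = 0) ->
  (exists2 M, 0 <= M & forall t, `|S' t| <= M) ->
  {within `[0, T], continuous U} -> 0 <= c <= T -> 0 < eta ->
  exists2 d, 0 < d & forall a e, 0 < e -> 2 * e < d -> 0 <= a -> a + e <= T ->
    (forall t, a <= t <= a + e -> `|c - t| <= 2 * e) ->
    `|\int[mu]_(t in D) (U t * (e^-1 * S' (e^-1 * t + - (a / e)))) - U c| <= eta.
Proof.
move=> cS dS S0 [M M0 SM] cU cT eta0.
have UL := L2_continuous cU.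
pose eta' := eta / (M + 1); have eta'0 : 0 < eta' by rewrite divr_gt0// ltr_wpDl.
have [d d0 Hd] : exists2 d, 0 < d & forall t, 0 <= t <= T -> `|c - t| < d ->
    `|U c - U t| <= eta'.
  have /subspace_continuousP/(_ c) := cU.
  rewrite /= in_itv/= => /(_ cT)/cvgrPdist_le/(_ _ eta'0).
  rewrite near_withinE => /nbhs_ballP[d /= d0 Hd].
  by exists d => // t tT ct; apply: Hd => //=; rewrite in_itv/=.
exists d => // a e e0 ed a0 aeT act.
pose k t := e^-1 * S' (e^-1 * t + - (a / e)).
have ck : continuous k.
  move=> t; apply: cvgM; first exact: cvg_cst.
  apply: (@continuous_comp _ _ _ (fun t => e^-1 * t + - (a / e)) S'); last exact: cS.
  by apply: cvgD; [apply: cvgM; [exact: cvg_cst|exact: cvg_id]|exact: cvg_cst].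
have kL : L2 T k by exact: L2_of_continuous.
have argE t : e^-1 * t + - (a / e) = (t - a) / e by ring.
have int_k : \int[mu]_(t in D) k t = 1.
  rewrite (Rintegral_derive T0 (is_derive_affine e^-1 (- (a / e)) dS) ck).
  rewrite !argE step_eq1 ?step_eq0 ?subr0//.
    by rewrite sub0r mulNr oppr_le0 divr_ge0// ltW.
  by rewrite ler_pdivlMr// mul1r; lra.
have -> : U c = \int[mu]_(t in D) (U c * k t).
  by rewrite RintegralZl ?int_k ?mulr1//; exact: L2_integrable.
have i1 := L2_mul_integrable UL kL.
have i2 : mu.-integrable D (EFin \o (fun t => U c * k t)).
  exact: L2_mul_integrable (L2_cst T (U c)) kL.
rewrite -RintegralB//; have i3 := integrableB mD i1 i2.
apply: le_trans (le_normr_Rintegral mD i3) _.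
have mI : measurable (`[a, a + e]%classic : set (measurableTypeR R)).
  exact: measurable_itv.
pose q (t : R) := eta' * (e^-1 * M) * \1_(`[a, a + e]%classic) t.
have iq : mu.-integrable setT (EFin \o q).
  have := integrable_indic_itv a (a + e) true false.
  by move=> /(integrableZl measurableT (eta' * (e^-1 * M))); apply: eq_integrable.
apply: (@le_trans _ _ (\int[mu]_(t in D) q t)).
  apply: le_Rintegral => //; first exact: integrable_norm.
  - by apply: integrableS iq.
  move=> t /= /[!in_itv]/= /andP[t0 tT]; rewrite -mulrBl normrM /q indicE.
  have [tae|tae] := boolP (a <= t <= a + e).
    rewrite mem_set ?mulr1//= ler_pM//.
      rewrite distrC; apply: Hd; first by rewrite (ltW t0) ltW.
      by rewrite (le_lt_trans _ ed)// act.
    by rewrite /k normrM gtr0_norm ?invr_gt0// ler_wpM2l ?invr_ge0// ltW.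
  rewrite /k S0.
    rewrite mulr0 normr0 mulr0 mulr_ge0//.
    by rewrite mulr_ge0 ?(ltW eta'0)// mulr_ge0// invr_ge0 ltW.
  rewrite argE; apply: contra tae => /andP[].
  rewrite ler_pdivlMr// mul0r ler_pdivrMr// mul1r => ? ?; apply/andP; split; lra.
apply: (@le_trans _ _ (\int[mu]_t q t)).
  apply: fine_le.
  - by apply: integrable_fin_num => //; exact: integrableS iq.
  - exact: integrable_fin_num.
  apply: ge0_subset_integral => //; first exact: (measurable_int mu iq).
  move=> t _; rewrite lee_fin mulr_ge0//.
  by rewrite mulr_ge0 ?(ltW eta'0)// mulr_ge0// invr_ge0 ltW.
rewrite /q RintegralZl//; last exact: integrable_indic_itv.
have muI : mu `[a, a + e]%classic = e%:E.
  by rewrite lebesgue_measure_itv/= lte_fin ltrDl e0/= -EFinB addrAC subrr add0r.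
have -> : \int[mu]_t \1_(`[a, a + e]%classic) t = e.
  by rewrite /Rintegral integral_indic// setIT; exact: (congr1 fine muI).
rewrite /eta' -[leLHS]mulrA.
rewrite [X in _ * X](_ : _ = M); last by field; rewrite gt_eqF.
rewrite -mulrA ler_piMr// ?(ltW eta0)// mulrC ler_pdivrMr ?ltr_wpDl// mul1r.
by rewrite lerDl.
Qed.

(** Testing the weak derivative with p times cut-offs that increase to the
    indicator of (0, T): the derivatives of the cut-offs concentrate at the two
    endpoints and produce the boundary terms. *)
Lemma weak_integration_by_parts u g p : {within `[0, T], continuous u} -> L2 T g ->
  is_weak_derivative T u g ->
  \int[mu]_(t in D) (u t * (deriv p).[t]) + \int[mu]_(t in D) (g t * p.[t]) =
  u T * p.[T] - u 0 * p.[0].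
Proof.
move=> cu gL ug; have uL := L2_continuous cu.
have [S' [sS' dS S0 SM]] := step_derive; have cS := smooth_continuous sS'.
(* the cut-off chi m is 1 on [2 e, T - 2 e] and 0 outside [e, T - e] *)
pose e m : R := T / 4 / m.+1%:R.
have e0 m : 0 < e m by rewrite !divr_gt0.
have e4 m : 4 * e m <= T.
  by rewrite /e mulrA mulrCA divff// mulr1 ler_piMr ?(ltW T0)// invf_le1// ler1n.
(* the factor -1 is written as a polynomial to stay in the class of smooth
   functions *)
pose chi m t := step ((e m)^-1 * t + - (e m / e m)) +
                (-1)%:P.[t] * step ((e m)^-1 * t + - ((T - 2 * e m) / e m)).
have argE m b t : (e m)^-1 * t + - (b / e m) = (t - b) / e m by ring.
pose chi' m t := (e m)^-1 * S' ((e m)^-1 * t + - (e m / e m)) -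
                 (e m)^-1 * S' ((e m)^-1 * t + - ((T - 2 * e m) / e m)).
have schi m : smooth (chi m).
  apply: smoothD; first exact: smooth_affine (@smooth_step R).
  by apply: smoothM; [exact: smooth_horner|exact: smooth_affine (@smooth_step R)].
have dchi m (t : R) : is_derive t (1 : R) (chi m) (chi' m t).
  have d1 := is_derive_affine (e m)^-1 (- (e m / e m)) dS t.
  have d2 := is_derive_affine (e m)^-1 (- ((T - 2 * e m) / e m)) dS t.
  have := is_deriveB d1 d2.
  rewrite (_ : (_ - _)%R = chi m)//; apply/funext => s.
  by rewrite /chi hornerC mulN1r.
have cchi m : continuous (chi m) by exact: smooth_continuous.
have chi1 m t : 2 * e m <= t -> t <= T - 2 * e m -> chi m t = 1.
  move=> t1 t2; rewrite /chi !argE hornerC step_eq1; last first.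
    by rewrite ler_pdivlMr// mul1r; lra.
  by rewrite step_eq0 ?mulr0 ?addr0// pmulr_lle0 ?invr_gt0//; lra.
have chi0 m t : ~~ (e m <= t <= T - e m) -> chi m t = 0.
  have em := e4 m; have em0 := e0 m.
  rewrite negb_and -!ltNge /chi !argE hornerC => /orP[t1|t1].
    by rewrite !step_eq0 ?mulr0 ?addr0// pmulr_lle0 ?invr_gt0//; lra.
  by rewrite !step_eq1 ?mulr1 ?addrN// ler_pdivlMr// mul1r; lra.
have chi_le1 m t : `|chi m t| <= 1.
  rewrite /chi hornerC mulN1r ler_norml.
  set x := step _; set y := step _.
  have := @step_ge0 R ((e m)^-1 * t + - (e m / e m)); rewrite -/x.
  have := @step_le1 R ((e m)^-1 * t + - (e m / e m)); rewrite -/x.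
  have := @step_ge0 R ((e m)^-1 * t + - ((T - 2 * e m) / e m)); rewrite -/y.
  have := @step_le1 R ((e m)^-1 * t + - ((T - 2 * e m) / e m)); rewrite -/y.
  by move=> *; apply/andP; split; lra.
pose phi m t := p.[t] * chi m t.
have tphi m : test_function T (phi m).
  have sub : closure [set t | phi m t != 0] `<=` `[e m, T - e m]%classic.
    rewrite closureE; apply: smallest_sub; first exact: interval_closed.
    move=> t /=; apply: contraR; rewrite in_itv/= => /chi0 c0.
    by rewrite /phi c0 mulr0.
  split.
  - move=> k t; apply: smooth_derivable; apply: smooth_derive1n.
    by apply: smoothM; [exact: smooth_horner|exact: schi].
  - apply: (subclosed_compact _ (@segment_compact _ (e m) (T - e m)) sub).
    exact: closed_closure.
  - move=> t /sub /=; rewrite !in_itv/= => /andP[t1 t2].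
    by rewrite (lt_le_trans (e0 m) t1)/= (le_lt_trans t2)// ltrBlDr ltrDl.
have dphi m t : derive1 (phi m) t = p.[t] * chi' m t + chi m t * (deriv p).[t].
  rewrite derive1E; have H := is_deriveM (is_derive_poly p t) (dchi m t).
  by have [_ ->] := H.
pose U t := u t * p.[t].
have cU : {within `[0, T], continuous U}.
  move=> t; apply: cvgM; first exact: cu.
  exact: (continuous_subspaceT (@continuous_horner R p)).
have UL := L2_continuous cU.
pose w t := u t * (deriv p).[t] + g t * p.[t].
have i1 := L2_mul_integrable uL (L2_horner T (deriv p)).
have i2 := L2_mul_integrable gL (L2_horner T p).
have iw : mu.-integrable D (EFin \o w) by exact: (integrableD mD i1 i2).
pose k m b t := (e m)^-1 * S' ((e m)^-1 * t + - (b / e m)).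
have ck m b : continuous (k m b).
  move=> t; apply: cvgM; first exact: cvg_cst.
  apply: (@continuous_comp _ _ _ (fun t => (e m)^-1 * t + - (b / e m)) S'); last exact: cS.
  by apply: cvgD; [apply: cvgM; [exact: cvg_cst|exact: cvg_id]|exact: cvg_cst].
pose L m := \int[mu]_(t in D) (w t * chi m t).
have mchi m : measurable_fun D (chi m).
  by apply: measurable_funTS; exact: continuous_measurable_fun.
have mwc m : measurable_fun D (fun t => w t * chi m t).
  apply: measurable_funM => //.
  by apply/measurable_EFinP; exact: (measurable_int mu iw).
have iwc m : mu.-integrable D (EFin \o (fun t => w t * chi m t)).
  have := iw; apply: le_integrable => //; first by apply/measurable_EFinP; exact: mwc.
  by move=> t _ /=; rewrite lee_fin normrM ler_piMr.
have LE m : L m = \int[mu]_(t in D) (U t * k m (T - 2 * e m) t) -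
                  \int[mu]_(t in D) (U t * k m (e m) t).
  have kL b := L2_of_continuous T (ck m b).
  have j1 := L2_mul_integrable UL (kL (e m)).
  have j2 := L2_mul_integrable UL (kL (T - 2 * e m)).
  have := ug _ (tphi m).
  have pL : L2 T (phi m).
    by apply: L2_of_continuous => //; exact: test_continuous (tphi m).
  have gp := L2_mul_integrable gL pL.
  have dpL := L2_of_continuous T (test_derive_continuous (tphi m)).
  have ud := L2_mul_integrable uL dpL.
  move/eqP; rewrite -addr_eq0 -RintegralD// => /eqP H.
  apply/eqP; rewrite -subr_eq0 opprB -RintegralB//; apply/eqP.
  rewrite -RintegralD//; last exact: (integrableB mD j1 j2).
  rewrite -[RHS]H; apply: eq_Rintegral => t _.
  by rewrite dphi /w /U /phi /chi' /k; ring.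
have eN (s : R) : 0 < s -> exists N, forall m, (N <= m)%N -> 2 * e m < s.
  move=> s0; exists (Num.truncn (T / s)) => m Nm.
  have : T < s * m.+1%:R.
    rewrite mulrC -ltr_pdivrMr// (lt_le_trans (truncnS_gt _))// ler_nat.
    by rewrite ltnS.
  rewrite -ltr_pdivrMr// => /(le_lt_trans _); apply.
  have -> : 2 * e m = T / m.+1%:R / 2 by rewrite /e (mulrAC T); move: (T / m.+1%:R) => y; lra.
  by rewrite ler_pdivrMr// ler_peMr ?divr_ge0 ?(ltW T0)// ler1n.
have lim1 : L @ \oo --> \int[mu]_(t in D) w t.
  have := @dominated_convergence _ _ _ mu D mD (fun m t => (w t * chi m t)%:E)
    (EFin \o w) (fun t => `|w t|%:E).
  case.
  - by move=> m; apply/measurable_EFinP; exact: mwc.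
  - exact: (measurable_int mu iw).
  - apply: aeW => t /= /[!in_itv]/= /andP[t0 tT].
    pose s := Num.min t (T - t); have s0 : 0 < s by rewrite lt_min t0 subr_gt0.
    have [N HN] := eN _ s0; apply: cvg_near_cst; exists N => // m /= /HN.
    rewrite lt_min => /andP[m1 m2].
    by rewrite chi1 ?mulr1//; lra.
  - exact: integrable_norm.
  - by apply: aeW => t m _ /=; rewrite lee_fin normrM ler_piMr.
  move=> _ _; rewrite -[X in _ --> X -> _]fineK; last exact: integrable_fin_num.
  by move/fine_cvg.
have lim2 : L @ \oo --> U T - U 0.
  apply/cvgrPdist_le => eta eta0; have eta2 : 0 < eta / 2 by rewrite divr_gt0.
  have c0 : 0 <= (0 : R) <= T by rewrite lexx ltW.
  have cT : 0 <= T <= T by rewrite lexx ltW.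
  have [d1 d10 H1] := approximate_identity cS dS S0 SM cU c0 eta2.
  have [d2 d20 H2] := approximate_identity cS dS S0 SM cU cT eta2.
  have d0 : 0 < Num.min d1 d2 by rewrite lt_min d10.
  have [N HN] := eN _ d0; exists N => // m /= /HN; rewrite lt_min => /andP[m1 m2].
  have em := e4 m; have em0 := e0 m.
  have {}H1 := H1 (e m) (e m) em0 m1 (ltW em0).
  have {}H2 := H2 (T - 2 * e m) (e m) em0 m2.
  have K1 : `|\int[mu]_(t in D) (U t * k m (e m) t) - U 0| <= eta / 2.
    apply: H1; first by lra.
    by move=> t /andP[t1 t2]; rewrite sub0r normrN ger0_norm//; lra.
  have K2 : `|\int[mu]_(t in D) (U t * k m (T - 2 * e m) t) - U T| <= eta / 2.
    apply: H2; [lra|lra|].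
    by move=> t /andP[t1 t2]; rewrite ger0_norm//; lra.
  rewrite LE distrC (splitr eta).
  rewrite [X in `|X|](_ : _ = (\int[mu]_(t in D) (U t * k m (T - 2 * e m) t) - U T) -
    (\int[mu]_(t in D) (U t * k m (e m) t) - U 0)); last by ring.
  by rewrite (le_trans (ler_normB _ _))// lerD.
rewrite -RintegralD//.
exact: (cvg_unique _ lim1 lim2).
Qed.

End integration_by_parts.

(** * The adjoint operator *)

Section weak_derivative_uniqueness.
Context {R : realType} (T : R).
Hypothesis T0 : 0 < T.
Notation mu := (@lebesgue_measure R).
Notation D := (`]0, T[%classic : set R).
Implicit Types (u g h : R -> R) (p : {poly R}).

Let mD : measurable (D : set (measurableTypeR R)).
Proof. exact: measurable_itv. Qed.

(** A difference of weak derivatives is a weak derivative of 0, hence orthogonal to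
    every polynomial, and polynomials are dense. *)
Lemma weak_derivative_unique u g h : L2 T g -> L2 T h ->
  is_weak_derivative T u g -> is_weak_derivative T u h ->
  g = h %[ae mu in D].
Proof.
move=> gL hL ug uh; pose d t := g t - h t.
have dL : L2 T d by exact: L2B.
have d0 : is_weak_derivative T (fun=> 0) d.
  move=> phi tphi; have pL := L2_of_continuous T (test_continuous tphi).
  have -> : \int[mu]_(t in D) (d t * phi t) =
      \int[mu]_(t in D) (g t * phi t) - \int[mu]_(t in D) (h t * phi t).
    rewrite -RintegralB//; try exact: L2_mul_integrable.
    by apply: eq_Rintegral => t _; rewrite mulrBl.
  have -> : \int[mu]_(t in D) (g t * phi t) = \int[mu]_(t in D) (h t * phi t).
    by apply: oppr_inj; rewrite -(ug _ tphi) -(uh _ tphi).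
  rewrite subrr oppr0.
  have := @Rintegral_cst _ _ _ mu D mD 0; rewrite mul0r => H; rewrite -[RHS]H.
  by apply: eq_Rintegral => t _; rewrite mul0r.
have orth p : \int[mu]_(t in D) (d t * p.[t]) = 0.
  have c0 : {within `[0, T], continuous (fun=> 0 : R)}.
    by apply: continuous_subspaceT; exact: cst_continuous.
  have := weak_integration_by_parts T0 p c0 dL d0.
  rewrite !mul0r subr0 (_ : \int[mu]_(t in D) _ = 0) ?add0r//.
  have := @Rintegral_cst _ _ _ mu D mD 0; rewrite mul0r => H; rewrite -[RHS]H.
  by apply: eq_Rintegral => t _; rewrite mul0r.
have id2 := L2_sqr_integrable dL.
have d2 : \int[mu]_(t in D) d t ^+ 2 = 0.
  apply/eqP; rewrite eq_le Rintegral_ge0 ?andbT; last by move=> t _; exact: sqr_ge0.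
  apply/ler_addgt0Pr => eps e0; rewrite add0r.
  have De t : D t -> t != 0 /\ `|t - 0| <= T.
    rewrite /= in_itv/= => /andP[t0 tT]; split; first by rewrite gt_eqF.
    by rewrite subr0 gtr0_norm// ltW.
  have [p Hp] := poly_dense_weighted T0 0 dL De e0.
  apply: le_trans Hp; have pL := L2_horner T p.
  have idp := L2_mul_integrable dL pL.
  have i2 : mu.-integrable D (EFin \o (fun t => 2 * (d t * p.[t]))).
    exact: (integrableZl mD 2 idp).
  have -> : \int[mu]_(t in D) d t ^+ 2 =
      \int[mu]_(t in D) (d t ^+ 2 - 2 * (d t * p.[t])).
    by rewrite RintegralB// RintegralZl// orth mulr0 subr0.
  apply: le_Rintegral => //.
  - exact: (integrableB mD id2 i2).
  - have := L2_sqr_integrable (L2B dL pL); apply: eq_integrable => // t _ /=.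
    by rewrite expr0 mul1r.
  - by move=> t _; rewrite expr0 mul1r; have := sqr_ge0 p.[t]; nra.
pose dd (t : R) := d t ^+ 2.
have : (\int[mu]_(t in D) `|(EFin \o dd) t| = 0)%E.
  under eq_integral do rewrite /= ger0_norm ?sqr_ge0//.
  rewrite -[LHS]fineK; first by congr EFin.
  exact: integrable_fin_num.
move/(ae_eq_integral_abs mu mD (measurable_int mu id2)).
apply: ae_mono => t /[apply] -[] /eqP; rewrite sqrf_eq0 => /eqP H.
by apply/eqP; rewrite -subr_eq0; apply/eqP.
Qed.

Lemma weak_derivativeP u : H1 T u ->
  L2 T (weak_derivative T u) /\ is_weak_derivative T u (weak_derivative T u).
Proof.
case=> _ _ [g ug]; apply: (@xgetPex _ (cst 0)
  [set g | L2 T g /\ is_weak_derivative T u g]).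
by exists g.
Qed.

End weak_derivative_uniqueness.

Section adjoint.
Context {R : realType} {n : nat} (T : R).
Hypothesis T0 : 0 < T.
Notation mu := (@lebesgue_measure R).
Notation D := (`]0, T[%classic : set R).
Implicit Types (E A M N : 'M[R]_n) (x y z : R -> 'cV[R]_n) (p : 'I_n -> {poly R}).

Let mD : measurable (D : set (measurableTypeR R)).
Proof. exact: measurable_itv. Qed.

Lemma Y_coord E y i : Y T E y -> H1 T (coord i y).
Proof. by case=> /(_ i). Qed.

Lemma X_of_Y E y : Y T E y -> X T y.
Proof. by move=> [yH _] i; have [] := yH i. Qed.

Lemma Y_lin E a y z : Y T E y -> Y T E z -> Y T E (a *: y + z).
Proof.
move=> [yH yT] [zH zT]; split.
  move=> i; have := H1_lin a (yH i) (zH i).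
  by congr H1; apply/funext => t; rewrite /coord !mxE.
by rewrite /= -[(a *: y + z) T]/(a *: y T + z T) rpredD// rpredZ.
Qed.

Lemma Y_0 E : Y T E (0 : R -> 'cV[R]_n).
Proof.
split; last by rewrite mem0v.
by move=> i; have := H1_0 T; congr H1; apply/funext => t; rewrite /coord mxE.
Qed.

Lemma Y_sum E (I : finType) (c : I -> R) (F : I -> R -> 'cV[R]_n) :
  (forall i, Y T E (F i)) -> Y T E (\sum_i c i *: F i).
Proof.
move=> FY; elim: (index_enum I) => [|i s IH]; first by rewrite big_nil; exact: Y_0.
by rewrite big_cons; exact: Y_lin.
Qed.

(** B* with the weak derivatives of the coordinates as a parameter g: the operation
    that selects a weak derivative does not commute with sums pointwise, whereas
    sums of weak derivatives can be inserted for g. *)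
Definition adjoint_op E A (g : 'I_n -> R -> R) y : R -> 'cV[R]_n := fun t =>
  - (E^T *m \col_i g i t) - A^T *m y t.

Lemma adjoint_opE E A g y t i :
  coord i (adjoint_op E A g y) t =
  \sum_j (- E j i * g j t - A j i * coord j y t).
Proof.
rewrite /coord !mxE -sumrN -sumrB; apply: eq_bigr => j _.
by rewrite !mxE mulNr.
Qed.

Lemma adjoint_op_X E A g y : (forall i, L2 T (g i)) -> X T y -> X T (adjoint_op E A g y).
Proof.
move=> gL Xy i.
have -> : coord i (adjoint_op E A g y) =
    (fun t => \sum_j (- E j i * g j t - A j i * coord j y t)).
  by apply/funext => t; rewrite adjoint_opE.
apply: (@L2_sum _ T 'I_n (fun j t => - E j i * g j t - A j i * coord j y t)) => j.
by apply: L2B; apply: L2Z; [exact: gL|exact: Xy].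
Qed.

Lemma Bstar_X E A y : Y T E y -> X T (Bstar T E A y).
Proof.
move=> yY; apply: adjoint_op_X; last exact: X_of_Y yY.
by move=> i; have [] := weak_derivativeP (Y_coord i yY).
Qed.

(** Uniqueness of weak derivatives makes their choice immaterial. *)
Lemma Bstar_adjoint_op E A g y : Y T E y -> (forall i, L2 T (g i)) ->
  (forall i, is_weak_derivative T (coord i y) (g i)) ->
  eqX T (Bstar T E A y) (adjoint_op E A g y).
Proof.
move=> yY gL yg.
have all_g : forall i, weak_derivative T (coord i y) = g i %[ae mu in D].
  move=> i; have [wL wd] := weak_derivativeP (Y_coord i yY).
  exact: (weak_derivative_unique T0 wL (gL i) wd (yg i)).
have : \forall t \ae mu, forall i, D t -> weak_derivative T (coord i y) t = g i t.
  by apply: (@filter_forall _ _ _ _ (ae_filter_ringOfSetsType mu)).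
apply: ae_mono => t gE Dt; rewrite /Bstar /adjoint_op; congr (- (_ *m _) - _).
by apply/matrixP => i j; rewrite !mxE gE.
Qed.

Lemma Bstar_lin E A a y z : Y T E y -> Y T E z ->
  eqX T (Bstar T E A (a *: y + z)) (a *: Bstar T E A y + Bstar T E A z).
Proof.
move=> yY zY; pose g i t := a * weak_derivative T (coord i y) t +
                            weak_derivative T (coord i z) t.
have wy i := weak_derivativeP (Y_coord i yY).
have wz i := weak_derivativeP (Y_coord i zY).
have -> : a *: Bstar T E A y + Bstar T E A z = adjoint_op E A g (a *: y + z).
  have col_lin (u w : 'cV[R]_n) i : (a *: u + w) i ord0 = a * u i ord0 + w i ord0.
    by rewrite !mxE.
  apply/funext => t; apply/matrixP => i j; rewrite (ord1 j).
  apply: (eq_trans (col_lin (Bstar T E A y t) (Bstar T E A z t) i)).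
  have BE w : Bstar T E A w t i ord0 =
      \sum_j (- E j i * weak_derivative T (coord j w) t - A j i * coord j w t).
    exact: (adjoint_opE E A (fun j => weak_derivative T (coord j w)) w t i).
  rewrite !BE; apply: eq_trans (esym (adjoint_opE E A g (a *: y + z) t i)).
  rewrite mulr_sumr -big_split/=; apply: eq_bigr => k _.
  have -> : coord k (a *: y + z) t = a * coord k y t + coord k z t by exact: col_lin.
  by rewrite /g; ring.
apply: Bstar_adjoint_op.
- exact: Y_lin.
- by move=> i; apply: L2D; [apply: L2Z|]; [have [] := wy i|have [] := wz i].
- move=> i; have [wyL wyd] := wy i; have [wzL wzd] := wz i.
  have := weak_derivative_lin a (X_of_Y yY i) (X_of_Y zY i) wyL wzL wyd wzd.
  by congr is_weak_derivative; apply/funext => t; rewrite /coord !mxE.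
Qed.

Lemma Bstar_sum E A (I : finType) (c : I -> R) (F : I -> R -> 'cV[R]_n) :
  (forall i, Y T E (F i)) ->
  eqX T (Bstar T E A (\sum_i c i *: F i)) (\sum_i c i *: Bstar T E A (F i)).
Proof.
move=> FY; elim: (index_enum I) => [|i s IH].
  rewrite !big_nil; have := Bstar_lin A 1 (Y_0 E) (Y_0 E).
  rewrite !scale1r addr0 => /eqXB/(_ (eqX_refl T (Bstar T E A 0))).
  by rewrite subrr addrK; exact: eqX_sym.
rewrite !big_cons; apply: eqX_trans (Bstar_lin A (c i) (FY i) _) _.
  by elim/big_ind : _ => *; [exact: Y_0|rewrite -[X in X + _]scale1r; exact: Y_lin|
    rewrite -[_ *: _]addr0; apply: Y_lin => //; exact: Y_0].
by apply: eqXD => //; exact: eqX_refl.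
Qed.

Definition poly_vec p : R -> 'cV[R]_n := fun t => \col_i (p i).[t].

Definition pencil_op M N p : R -> 'cV[R]_n := fun t =>
  \col_i \sum_j (M i j * (deriv (p j)).[t] + N i j * (p j).[t]).

Lemma poly_vec_X p : X T (poly_vec p).
Proof.
move=> i; have := L2_horner T (p i); congr L2.
by apply/funext => t; rewrite /coord mxE.
Qed.

Lemma pencil_op_X M N p : X T (pencil_op M N p).
Proof.
move=> i; have -> : coord i (pencil_op M N p) =
  fun t => \sum_j (M i j * (deriv (p j)).[t] + N i j * (p j).[t]).
  by apply/funext => t; rewrite /coord mxE.
apply: (@L2_sum _ T 'I_n (fun j t => M i j * (deriv (p j)).[t] + N i j * (p j).[t])).
by move=> j; apply: L2D; apply: L2Z; exact: L2_horner.
Qed.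

(** Images of polynomials vanishing at an endpoint e under M d/dt + N are dense:
    a given x is first approximated by polynomials vanishing at e to the order
    required by the algebraic solution of the system. *)
Lemma pencil_dense M N (e : R) x (eps : R) :
  (exists lambda, \det (lambda *: M + N) != 0) ->
  (forall t, D t -> t != e /\ `|t - e| <= T) -> X T x -> 0 < eps ->
  exists p, (forall i, (p i).[e] = 0) /\ normX T (x - pencil_op M N p) <= eps.
Proof.
move=> reg De Xx e0; have [B HB] := pencil_approx_surj e reg (ltW T0).
pose d := eps ^+ 2 / (4 * n.+1%:R).
have d0 : 0 < d by rewrite divr_gt0 ?exprn_gt0// mulr_gt0.
have [q Hq] := choice (fun i => poly_dense_weighted T0 B (Xx i) De d0).
have eta0 : 0 < Num.sqrt (d / T) by rewrite sqrtr_gt0 divr_gt0.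
have [p [pe Hp]] := HB q _ eta0; exists p; split=> //.
have Xd := X_B Xx (pencil_op_X M N p).
rewrite -(@ler_pXn2r _ 2) ?nnegrE ?normX_ge0 ?(ltW e0)// sqr_normX innerX_sum//.
have coordB i t : coord i (x - pencil_op M N p) t = coord i x t - coord i (pencil_op M N p) t.
  by rewrite /coord !mxE.
have dE : 2 * d + 2 * d = eps ^+ 2 / n.+1%:R.
  by rewrite /d invfM; move: (n.+1%:R^-1) => y; lra.
apply: (@le_trans _ _ (\sum_(i < n) (2 * d + 2 * d))); last first.
  rewrite dE sumr_const card_ord -[leLHS]mulr_natl mulrCA.
  by rewrite ler_piMr ?sqr_ge0// ler_pdivrMr// mul1r ler_nat.
apply: ler_sum => i _; under eq_Rintegral do rewrite coordB -expr2.
pose r : {poly R} := ('X - e%:P) ^+ B * q i.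
have rE t : r.[t] = (t - e) ^+ B * (q i).[t] by rewrite /r hornerM horner_exp hornerXsubC.
have PL := pencil_op_X M N p i.
apply: (L2_dist_trans (v := horner r)) => //; first exact: L2_horner.
  by have := Hq i; congr (_ <= _); apply: eq_Rintegral => t _; rewrite rE.
apply: (@le_trans _ _ (\int[mu]_(t in D) (d / T))).
  apply: le_Rintegral => //.
  - exact: L2_sqr_integrable (L2B (L2_horner T r) PL).
  - exact: L2_integrable (L2_cst T _).
  move=> t Dt; have [_ tT] := De t Dt; have := Hp i t tT.
  rewrite distrC -rE => H; rewrite -real_normK ?num_real//.
  rewrite -[leRHS]sqr_sqrtr; last by rewrite divr_ge0// ltW.
  rewrite lerXn2r ?nnegrE ?(ltW eta0)//.
  by move: H; rewrite /coord mxE.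
rewrite Rintegral_cst//= lebesgue_measure_itv/= lte_fin T0 /= oppr0 addr0.
by rewrite divfK// gt_eqF.
Qed.

Lemma interior_dist0 t : D t -> t != 0 /\ `|t - 0| <= T.
Proof.
rewrite /= in_itv/= => /andP[t0 tT]; split; first by rewrite gt_eqF.
by rewrite subr0 gtr0_norm// ltW.
Qed.

Lemma interior_distT t : D t -> t != T /\ `|t - T| <= T.
Proof.
rewrite /= in_itv/= => /andP[t0 tT]; split; first by rewrite lt_eqF.
by rewrite ler0_norm; lra.
Qed.

(** Polynomials vanishing at T belong to Y for every E, and their images are
    already dense. *)
Lemma Bstar_dense E A x (eps : R) : (exists lambda, \det (lambda *: E - A) != 0) ->
  X T x -> 0 < eps ->
  exists2 y, Y T E y & normX T (x - Bstar T E A y) <= eps.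
Proof.
move=> [lambda reg] Xx e0.
have reg' : exists l, \det (l *: (- E^T) + (- A^T)) != 0.
  exists (- lambda); rewrite scalerN scaleNr opprK -det_tr linearB/= linearZ/=.
  by rewrite !trmxK.
have [p [pT Hp]] := pencil_dense reg' interior_distT Xx e0.
have pY : Y T E (poly_vec p).
  split; last first.
    by rewrite (_ : poly_vec p T = 0) ?mem0v//; apply/matrixP => i j; rewrite !mxE pT.
  move=> i; have := H1_horner T (p i); congr H1.
  by apply/funext => t; rewrite /coord mxE.
exists (poly_vec p); first exact: pY.
apply: le_trans Hp.
rewrite (@normX_eqX _ _ _ _ (x - pencil_op (- E^T) (- A^T) p))//.
- by apply: X_B => //; exact: Bstar_X.
- by apply: X_B => //; exact: pencil_op_X.
apply: eqXB; first exact: eqX_refl.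
have -> : pencil_op (- E^T) (- A^T) p =
    adjoint_op E A (fun i => horner (deriv (p i))) (poly_vec p).
  apply/funext => t; apply/matrixP => i j; rewrite (ord1 j).
  rewrite -[RHS]/(coord i _ t) adjoint_opE mxE; apply: eq_bigr => k _.
  by rewrite /coord !mxE !mulNr.
apply: Bstar_adjoint_op => // i; first exact: L2_horner.
have := @weak_derivative_horner R T (p i); congr is_weak_derivative.
by apply/funext => t; rewrite /coord mxE.
Qed.

(** The kernel of B* is orthogonal to the range of the formal adjoint
    E d/dt - A on polynomials vanishing at 0; the boundary term at T disappears
    because y T lies in the kernel of E^T. *)
Lemma Bstar_injective E A y : (exists lambda, \det (lambda *: E - A) != 0) ->
  Y T E y -> eqX T (Bstar T E A y) 0 -> eqX T y 0.
Proof.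
move=> reg yY By0; have Xy := X_of_Y yY; have XB := Bstar_X A yY.
have orth p : (forall i, (p i).[0] = 0) -> innerX T (pencil_op E (- A) p) y = 0.
  move=> p0; pose g i := weak_derivative T (coord i y).
  have gP i : L2 T (g i) /\ is_weak_derivative T (coord i y) (g i).
    exact: weak_derivativeP (Y_coord i yY).
  have Xp := poly_vec_X p.
  have <- : innerX T (Bstar T E A y) (poly_vec p) = 0.
    have X0 := @X_0 R T n.
    by rewrite (innerX_eqX XB X0 Xp By0) innerX0l.
  pose S i j := \int[mu]_(t in D) ((deriv (p i)).[t] * coord j y t).
  pose Q i j := \int[mu]_(t in D) ((p i).[t] * coord j y t).
  have boundary i j : \int[mu]_(t in D) (g j t * (p i).[t]) =
      coord j y T * (p i).[T] - S i j.
    have [gL gd] := gP j; have [_ cy _] := Y_coord j yY.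
    have := weak_integration_by_parts T0 (p i) cy gL gd.
    rewrite p0 mulr0 subr0 => <-; rewrite addrAC [X in X - _ + _](_ : _ = S i j).
      by rewrite subrr add0r.
    by apply: eq_Rintegral => t _; rewrite mulrC.
  have kerE i : \sum_j E j i * coord j y T = 0.
    have [_] := yY; rewrite /= /kerT memv_ker lfunE/= => /eqP/matrixP/(_ i ord0).
    by rewrite !mxE => H; rewrite -[RHS]H; apply: eq_bigr => j _; rewrite mxE.
  transitivity (\sum_i \sum_j (E j i * S i j + - A j i * Q i j)).
    rewrite innerX_sum//; last exact: pencil_op_X.
    rewrite [RHS]exchange_big; apply: eq_bigr => i _.
    transitivity (\int[mu]_(t in D) \sum_j
        ((E i j * (deriv (p j)).[t] + - A i j * (p j).[t]) * coord i y t)).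
      apply: eq_Rintegral => t _; rewrite {1}/coord mxE mulr_suml.
      by apply: eq_bigr => j _; rewrite mxE.
    rewrite Rintegral_sum => [|j].
      by apply: eq_bigr => j _; rewrite Rintegral_lin2//; exact: L2_horner.
    by apply: L2_mul_integrable => //; apply: L2D; apply: L2Z; exact: L2_horner.
  rewrite innerX_sum//.
  transitivity (\sum_i (\sum_j (E j i * S i j + - A j i * Q i j) -
                  (p i).[T] * \sum_j E j i * coord j y T)).
    by apply: eq_bigr => i _; rewrite kerE mulr0 subr0.
  apply: eq_bigr => i _.
  transitivity (\int[mu]_(t in D) \sum_j
      ((- E j i * g j t + - A j i * coord j y t) * (p i).[t])); last first.
    apply: eq_Rintegral => t _; rewrite -mulr_suml; congr (_ * _); last by rewrite /coord mxE.
    by rewrite (adjoint_opE E A g y t i); apply: eq_bigr => j _; rewrite !mulNr.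
  rewrite Rintegral_sum => [|j]; last first.
    apply: L2_mul_integrable; last exact: L2_horner.
    by apply: L2D; apply: L2Z; [have [] := gP j|].
  rewrite mulr_sumr -sumrB; apply: eq_bigr => j _.
  rewrite Rintegral_lin2 ?boundary//; [|by have [] := gP j|exact: L2_horner].
  rewrite (_ : \int[mu]_(t in D) (coord j y t * (p i).[t]) = Q i j); last first.
    by apply: eq_Rintegral => t _; rewrite mulrC.
  ring.
have [//|y0] := eqVneq (normX T y) 0; first exact: normX_eq0.
have ypos : 0 < normX T y by rewrite lt0r y0 normX_ge0.
have reg' : exists l, \det (l *: E + (- A)) != 0 by [].
have e0 : 0 < normX T y / 2 by rewrite divr_gt0.
have [p [p0 Hp]] := pencil_dense reg' interior_dist0 Xy e0.
have Xp := pencil_op_X E (- A) p.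
have : normX T y ^+ 2 <= normX T y / 2 * normX T y.
  rewrite sqr_normX -[leLHS]subr0 -(orth p p0) -innerXBl//.
  rewrite (le_trans (innerX_le_norm _ _))//; first exact: X_B.
  by rewrite ler_wpM2r ?normX_ge0.
by rewrite expr2 ler_pM2r// => ?; exfalso; lra.
Qed.

End adjoint.

(** * The ansatz spaces *)

Section ansatz.
Context {R : realType} {n : nat} (T : R) (E A : 'M[R]_n).
Hypothesis T0 : 0 < T.
Hypothesis reg : exists lambda, \det (lambda *: E - A) != 0.
Notation mu := (@lebesgue_measure R).
Notation D := (`]0, T[%classic : set R).
Notation Bs := (Bstar T E A).
Implicit Types (x y z w : R -> 'cV[R]_n) (V : set (R -> 'cV[R]_n)).

Let mD : measurable (D : set (measurableTypeR R)).
Proof. exact: measurable_itv. Qed.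

(** B* is well defined on classes: 0 is a weak derivative of a function that
    vanishes almost everywhere. *)
Lemma Bstar_eq0 y : Y T E y -> eqX T y 0 -> eqX T (Bs y) 0.
Proof.
move=> yY y0; apply: (@eqX_trans _ _ _ (adjoint_op E A (fun _ _ => 0) y)).
  apply: Bstar_adjoint_op => // i; first exact: L2_cst.
  move=> phi tphi; have dL := L2_of_continuous T (test_derive_continuous tphi).
  have R0 : \int[mu]_(t in D) (0 : R) = 0 by rewrite Rintegral_cst// mul0r.
  transitivity (\int[mu]_(t in D) (0 : R)).
    congr fine; apply: ae_eq_integral => //.
      exact: (measurable_int mu (L2_mul_integrable (X_of_Y yY i) dL)).
    by move: y0; apply: ae_mono => t H Dt; rewrite /coord H// mxE mul0r.
  rewrite R0; apply/eqP; rewrite eq_sym oppr_eq0; apply/eqP; rewrite -[RHS]R0.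
  by apply: eq_Rintegral => t _; rewrite mul0r.
move: y0; apply: ae_mono => t H Dt; apply/matrixP => i j; rewrite (ord1 j).
rewrite -[LHS]/(coord i _ t) adjoint_opE mxE big1// => k _.
by rewrite /coord H// mxE !mulr0 subr0.
Qed.

Lemma Bstar_nonzero y : Y T E y -> 0 < normX T (Bs y) -> nonzero T y.
Proof.
move=> yY By y0; have := Bstar_eq0 yY y0.
have XB := Bstar_X A yY; move/(normX_eqX XB (@X_0 _ _ _)).
by rewrite normX_0 => B0; rewrite B0 ltxx in By.
Qed.

Lemma normXB_sym x y : normX T (x - y) = normX T (y - x).
Proof. by rewrite -normXN opprB. Qed.

(** If x is a limit of B* V, then y almost maximises the quotient of b x as soon
    as B* y is close to x. *)
Lemma almost_supremizer V x (d : R) : V `<=` Y T E -> X T x -> nonzero T x ->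
  (forall e, 0 < e -> exists2 y, V y & normX T (x - Bs y) <= e) ->
  0 < d <= 1 ->
  exists y, [/\ V y, nonzero T y, 0 < normX T (Bs y) &
    (1 - d) * (normX T x * normX T (Bs y)) <= innerX T x (Bs y)].
Proof.
move=> VY Xx nx dense /andP[d0 d1]; have x0 := normX_gt0 Xx nx.
have e0 : 0 < d * normX T x / 2 by rewrite divr_gt0// mulr_gt0.
have [y Vy Hy] := dense _ e0; have yY := VY _ Vy; have XB := Bstar_X A yY.
have Xd := X_B Xx XB.
have up : normX T (Bs y) <= normX T x + d * normX T x / 2.
  have -> : Bs y = x + (Bs y - x) by rewrite addrCA subrr addr0.
  rewrite (le_trans (normXD _ _))//; first exact: X_B.
  by rewrite lerD2l normXB_sym.
have low : normX T x <= normX T (Bs y) + d * normX T x / 2.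
  rewrite -{1}(subrK (Bs y) x) addrC (le_trans (normXD _ _))//.
  by rewrite lerD2l.
have By0 : 0 < normX T (Bs y) by nra.
exists y; split => //; first exact: Bstar_nonzero.
have -> : innerX T x (Bs y) = normX T x ^+ 2 - innerX T x (x - Bs y).
  by rewrite sqr_normX (innerXC T x (x - Bs y)) innerXBl// opprB addrCA subrr addr0 innerXC.
apply: (@le_trans _ _ ((1 - d) * (normX T x * (normX T x + d * normX T x / 2)))).
  by rewrite ler_wpM2l ?subr_ge0// ler_wpM2l// ltW.
apply: (@le_trans _ _ (normX T x ^+ 2 - normX T x * (d * normX T x / 2))); last first.
  rewrite lerD2l lerN2 (le_trans (innerX_le_norm Xx Xd))//.
  by rewrite ler_wpM2l// ltW.
rewrite -subr_ge0 [leRHS](_ : _ = (d * normX T x) ^+ 2 / 2); last by field.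
by rewrite divr_ge0// sqr_ge0.
Qed.

Lemma le_ereal_sup_scaled (S : set (\bar R)) (a : R) : 0 <= a ->
  (forall d, 0 < d <= 1 -> (((1 - d) * a)%:E <= ereal_sup S)%E) ->
  (a%:E <= ereal_sup S)%E.
Proof.
move=> a0 H; apply/lee_addgt0Pr => e e0.
pose d := Num.min 1 (e / (a + 1)).
have a1 : 0 < a + 1 by rewrite ltr_wpDl.
have d01 : 0 < d <= 1 by rewrite lt_min ltr01 divr_gt0//= ge_min lexx.
apply: (@le_trans _ _ (((1 - d) * a)%:E + e%:E)%E); last by rewrite leeD2r// H.
rewrite -EFinD lee_fin mulrBl mul1r -addrA lerDl addrC subr_ge0.
have de : d <= e / (a + 1) by rewrite ge_min lexx orbT.
apply: (@le_trans _ _ (e / (a + 1) * a)); first by rewrite ler_wpM2r.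
by rewrite mulrAC ler_pdivrMr// ler_wpM2l ?(ltW e0)// lerDl.
Qed.

(** The Cauchy-Schwarz inequality bounds the quotient by 1, because |||y||| is the
    norm of B* y; density makes the bound sharp. *)
Lemma sup_quotient_eq1 V x : V `<=` Y T E -> X T x -> nonzero T x ->
  (forall e, 0 < e -> exists2 y, V y & normX T (x - Bs y) <= e) ->
  sup_quotient T E A V x = 1%E.
Proof.
move=> VY Xx nx dense; have x0 := normX_gt0 Xx nx; apply/eqP; rewrite eq_le.
apply/andP; split.
  apply: ge_ereal_sup => _ [y [Vy _] <-]; rewrite lee_fin.
  have XB := Bstar_X A (VY _ Vy).
  have [B0|B0] := eqVneq (normX T (Bs y)) 0.
    by rewrite /normY B0 mulr0 invr0 mulr0.
  rewrite ler_pdivrMr ?mul1r; first exact: innerX_le_norm.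
  by rewrite mulr_gt0// lt0r B0 normX_ge0.
apply: le_ereal_sup_scaled => // d d01.
have [y [Vy ny By Hy]] := almost_supremizer VY Xx nx dense d01.
apply: le_trans (ereal_sup_ubound _); last by exists y.
by rewrite lee_fin mulr1 ler_pdivlMr// mulr_gt0.
Qed.

Lemma Y_dense x : X T x ->
  forall e, 0 < e -> exists2 y, Y T E y & normX T (x - Bs y) <= e.
Proof. by move=> Xx e e0; exact: Bstar_dense. Qed.

Lemma infsup_eq1 (U V : set (R -> 'cV[R]_n)) :
  (exists x, U x /\ nonzero T x) ->
  (forall x, U x -> nonzero T x -> sup_quotient T E A V x = 1%E) ->
  infsup T E A U V = 1%E.
Proof.
move=> [x0 [Ux0 nx0]] H; rewrite /infsup.
rewrite (_ : [set _ | x in _] = [set 1%E]) ?ereal_inf1//.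
apply/seteqP; split => [_ [x [Ux nx] <-]|_ ->]; first exact: H.
by exists x0 => //; exact: H.
Qed.

Lemma gamma_eq1 : (exists x, X T x /\ nonzero T x) -> gamma T E A = 1%E.
Proof.
move=> [x0 [Xx0 nx0]]; rewrite /gamma.
have H x : X T x -> nonzero T x -> sup_quotient T E A (Y T E) x = 1%E.
  by move=> Xx nx; apply: sup_quotient_eq1 => //; exact: Y_dense.
rewrite (_ : [set _ | x in _] = [set 1%E]) ?ereal_sup1//.
apply/seteqP; split => [_ [x [Xx nx] <-]|_ ->]; first exact: H.
by exists x0 => //; exact: H.
Qed.

Section galerkin.
Context (N : nat) (F : 'I_N -> R -> 'cV[R]_n).
Hypothesis N0 : (0 < N)%N.
Hypothesis FY : forall i, Y T E (F i).
Hypothesis Ffree : forall c : 'I_N -> R, eqX T (\sum_i c i *: F i) 0 -> forall i, c i = 0.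

Lemma sum_delta (G : 'I_N -> R -> 'cV[R]_n) i : \sum_j (j == i)%:R *: G j = G i.
Proof.
rewrite (bigD1 i)//= eqxx scale1r big1 ?addr0// => j /negbTE ->.
by rewrite scale0r.
Qed.

Definition ansatz : set (R -> 'cV[R]_n) := [set y | exists c : 'I_N -> R, y = \sum_i c i *: F i].

Definition adjoint_ansatz : set (R -> 'cV[R]_n) :=
  [set x | X T x /\ exists2 y, ansatz y & eqX T x (Bs y)].

Let comb (c : 'I_N -> R) := \sum_i c i *: F i.

Let comb_Y c : Y T E (comb c).
Proof. exact: Y_sum. Qed.

Let BX c : X T (Bs (comb c)).
Proof. exact: Bstar_X. Qed.

Let BF i : X T (Bs (F i)).
Proof. exact: Bstar_X. Qed.

Lemma ansatz_Y : ansatz `<=` Y T E.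
Proof. by move=> _ [c ->]; exact: comb_Y. Qed.

Lemma ansatz_B y z : ansatz y -> ansatz z -> ansatz (y - z).
Proof.
move=> [c ->] [c' ->]; exists (fun i => c i - c' i).
by rewrite -sumrB; apply: eq_bigr => i _; rewrite scalerBl.
Qed.

Lemma Bstar_B y z : Y T E y -> Y T E z -> eqX T (Bs (y - z)) (Bs y - Bs z).
Proof.
move=> yY zY; have := Bstar_lin T0 A (-1) zY yY.
by rewrite !scaleN1r ![- _ + _]addrC.
Qed.

Lemma adjoint_ansatz_B x w : adjoint_ansatz x -> adjoint_ansatz w ->
  adjoint_ansatz (x - w).
Proof.
move=> [Xx [y Vy xy]] [Xw [z Vz wz]]; split; first exact: X_B.
exists (y - z); first exact: ansatz_B.
apply: eqX_trans (eqXB xy wz) _; apply: eqX_sym.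
by apply: Bstar_B; exact: ansatz_Y.
Qed.

Lemma Bstar_free (c : 'I_N -> R) : eqX T (\sum_i c i *: Bs (F i)) 0 -> forall i, c i = 0.
Proof.
move=> c0; apply: Ffree; apply: (Bstar_injective T0 reg); first exact: comb_Y.
exact: eqX_trans (Bstar_sum T0 A c FY) c0.
Qed.

Lemma has_dim_ansatz : has_dim T ansatz N.
Proof.
exists F; split => // [i|_ [c ->]]; last by exists c; exact: eqX_refl.
by exists (fun j => (j == i)%:R); rewrite sum_delta.
Qed.

Lemma adjoint_ansatz_F i : adjoint_ansatz (Bs (F i)).
Proof.
split; first exact: BF.
exists (F i); last exact: eqX_refl.
by exists (fun j => (j == i)%:R); rewrite sum_delta.
Qed.

(** B* is injective, so it carries a basis of test functions to a basis of trial
    functions. *)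
Lemma has_dim_adjoint_ansatz : has_dim T adjoint_ansatz N.
Proof.
exists (fun i => Bs (F i)); split.
- exact: adjoint_ansatz_F.
- exact: Bstar_free.
- move=> x [Xx [_ [c ->] xB]]; exists c; apply: eqX_trans xB _.
  exact: Bstar_sum.
Qed.

Lemma adjoint_ansatz_nonzero : exists x, adjoint_ansatz x /\ nonzero T x.
Proof.
pose i0 := Ordinal N0; exists (Bs (F i0)); split; first exact: adjoint_ansatz_F.
move=> B0; have := @Bstar_free (fun j => (j == i0)%:R).
rewrite sum_delta => /(_ B0 i0); rewrite eqxx => /eqP.
by rewrite oner_eq0.
Qed.

(** A trial function is itself the image under B* of a test function, so the
    density hypothesis holds with error 0. *)
Lemma betaN_eq1 : infsup T E A adjoint_ansatz ansatz = 1%E.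
Proof.
apply: infsup_eq1; first exact: adjoint_ansatz_nonzero.
move=> x [Xx [y Vy xy]] nx; apply: sup_quotient_eq1 => //; first exact: ansatz_Y.
move=> e e0; exists y => //; have XB := Bstar_X A (ansatz_Y Vy).
rewrite (normX_eqX (X_B Xx XB) (@X_0 _ _ _)) ?normX_0 ?(ltW e0)//.
exact/eqX_subr0.
Qed.

Lemma beta_eq1 : beta T E A = 1%E.
Proof.
have [x [[Xx _] nx]] := adjoint_ansatz_nonzero; apply: infsup_eq1; first by exists x.
by move=> z Xz nz; apply: sup_quotient_eq1 => //; exact: Y_dense.
Qed.

Definition gram : 'M[R]_N := \matrix_(i, j) innerX T (Bs (F i)) (Bs (F j)).

Lemma innerX_comb (c d : 'I_N -> R) :
  innerX T (Bs (comb c)) (Bs (comb d)) = \sum_j (\sum_i c i * gram i j) * d j.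
Proof.
have Xs (e : 'I_N -> R) : X T (\sum_i e i *: Bs (F i)).
  by apply: X_sum => i; exact: X_Z.
rewrite (innerX_eqX (BX c) (Xs c) (BX d) (Bstar_sum T0 A c FY)) innerXC.
rewrite (innerX_eqX (BX d) (Xs d) (Xs c) (Bstar_sum T0 A d FY)).
rewrite innerX_suml//; last by move=> i; exact: X_Z.
apply: eq_bigr => j _; rewrite innerXZl// mulrC; congr (_ * _).
rewrite innerXC innerX_suml//; last by move=> i; exact: X_Z.
by apply: eq_bigr => i _; rewrite innerXZl// mxE.
Qed.

(** A vector in the kernel of the Gram matrix gives an element of B* V of norm 0. *)
Lemma gram_unit : gram \in unitmx.
Proof.
rewrite -row_free_unit; apply: inj_row_free => c c0.
have cE j : \sum_i c ord0 i * gram i j = 0.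
  by have /matrixP/(_ ord0 j) := c0; rewrite !mxE.
have : innerX T (Bs (comb (c ord0))) (Bs (comb (c ord0))) = 0.
  by rewrite innerX_comb big1// => j _; rewrite cE mul0r.
rewrite -sqr_normX => /eqP; rewrite sqrf_eq0 => /eqP /(normX_eq0 (BX _)) B0.
apply/matrixP => i j; rewrite (ord1 i) mxE.
by apply: (@Ffree (c ord0)); exact: (Bstar_injective T0 reg (comb_Y _) B0).
Qed.

Context (f : (R -> 'cV[R]_n) -> R).
Hypothesis fdual : dualY T E A f.

Lemma dual_sum (c : 'I_N -> R) : f (comb c) = \sum_i c i * f (F i).
Proof.
have [flin _] := fdual.
have f0 : f 0 = 0.
  have := flin 1 0 0 (Y_0 T E) (Y_0 T E); rewrite scaler0 addr0 mul1r.
  by move/eqP; rewrite -subr_eq0 opprD addrA subrr sub0r oppr_eq0 => /eqP.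
rewrite /comb; suff : forall s : seq 'I_N, Y T E (\sum_(i <- s) c i *: F i) /\
    f (\sum_(i <- s) c i *: F i) = \sum_(i <- s) c i * f (F i).
  by move=> /(_ (index_enum 'I_N))[].
elim => [|i s [IHY IH]]; first by rewrite !big_nil; split => //; exact: Y_0.
by rewrite !big_cons; split; [exact: Y_lin|rewrite flin// IH].
Qed.

Definition galerkin x := adjoint_ansatz x /\ forall y, ansatz y -> b T E A x y = f y.

(** The coefficients solve the normal equations, whose matrix is the Gram matrix
    of the images of the basis under B*. *)
Lemma galerkin_exists : exists x, galerkin x.
Proof.
pose c := (\row_j f (F j)) *m invmx gram.
exists (Bs (comb (c ord0))); split.
  split; first exact: BX.
  by exists (comb (c ord0)); [exists (c ord0)|exact: eqX_refl].
move=> _ [d ->]; rewrite -/(comb d) /b innerX_comb dual_sum; apply: eq_bigr => j _.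
rewrite mulrC; congr (_ * _); have := mulmxKV gram_unit (\row_j f (F j)).
by move=> /matrixP/(_ ord0 j); rewrite -/c !mxE.
Qed.

Lemma galerkin_unique x z : galerkin x -> galerkin z -> eqX T z x.
Proof.
move=> [Wx xf] [Wz zf]; apply/eqX_subr0.
have [Xd [y Vy dy]] := adjoint_ansatz_B Wz Wx.
have [[Xx _] [Xz _]] := (Wx, Wz); have XB := Bstar_X A (ansatz_Y Vy).
apply: normX_eq0 => //; apply/eqP; rewrite -sqrf_eq0 sqr_normX.
rewrite (innerX_eqX Xd XB Xd dy) innerXC innerXBl//.
by rewrite -/(b T E A z y) -/(b T E A x y) xf// zf// subrr.
Qed.

Section error.
Context (x xN : R -> 'cV[R]_n).
Hypothesis Xx : X T x.
Hypothesis xf : forall y, Y T E y -> b T E A x y = f y.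
Hypothesis xNf : galerkin xN.

Let XxN : X T xN. Proof. by case: xNf => -[]. Qed.
Let Xd : X T (x - xN). Proof. exact: X_B. Qed.

Lemma galerkin_orthogonal w : adjoint_ansatz w -> innerX T (x - xN) w = 0.
Proof.
move=> [Xw [y Vy wy]]; have yY := ansatz_Y Vy; have XB := Bstar_X A yY.
rewrite innerXC (innerX_eqX Xw XB Xd wy) innerXC innerXBl//.
by case: xNf => _ H; rewrite -/(b T E A x y) -/(b T E A xN y) xf// H// subrr.
Qed.

(** By orthogonality the Galerkin solution is the orthogonal projection of x. *)
Lemma galerkin_best : (normX T (x - xN))%:E =
  ereal_inf [set (normX T (x - w))%:E | w in adjoint_ansatz].
Proof.
apply/eqP; rewrite eq_le; apply/andP; split; last first.
  by apply: ereal_inf_lbound; exists xN => //; case: xNf.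
apply: le_ereal_inf_tmp => _ [w Ww <-]; rewrite lee_fin; have [Xw _] := Ww.
have [->|d0] := eqVneq (normX T (x - xN)) 0; first exact: normX_ge0.
have dpos : 0 < normX T (x - xN) by rewrite lt0r d0 normX_ge0.
have WxN : adjoint_ansatz xN by case: xNf.
rewrite -(ler_pM2l dpos) -expr2 sqr_normX.
have -> : innerX T (x - xN) (x - xN) = innerX T (x - xN) (x - w).
  have -> : x - w = (x - xN) + (xN - w) by rewrite addrA subrK.
  rewrite [RHS]innerXC [RHS]innerXDl//; last exact: X_B.
  by rewrite (innerXC T (xN - w)) (galerkin_orthogonal (adjoint_ansatz_B WxN Ww)) addr0.
by apply: innerX_le_norm => //; exact: X_B.
Qed.

Lemma residualE y : Y T E y -> residual T E A f xN y = innerX T (x - xN) (Bs y).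
Proof.
by move=> yY; have XB := Bstar_X A yY; rewrite innerXBl// /residual -xf.
Qed.

(** The residual is y |-> (x - xN, B* y), whose dual norm is the norm of x - xN
    because B* Y is dense. *)
Lemma error_residual : (normX T (x - xN))%:E = dual_norm T E A (residual T E A f xN).
Proof.
apply/eqP; rewrite eq_le; apply/andP; split; last first.
  apply: ge_ereal_sup => _ [y [yY _] <-]; rewrite lee_fin residualE//.
  have XB := Bstar_X A yY; rewrite /normY.
  have [->|B0] := eqVneq (normX T (Bs y)) 0; first by rewrite invr0 mulr0 normX_ge0.
  by rewrite ler_pdivrMr ?lt0r ?B0 ?normX_ge0//; exact: innerX_le_norm.
have [nd|zd] := pselect (nonzero T (x - xN)).
  apply: le_ereal_sup_scaled => [|d d01]; first exact: normX_ge0.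
  have [y [yY ny By Hy]] :=
    almost_supremizer (@subset_refl _ (Y T E)) Xd nd (Y_dense Xd) d01.
  apply: le_trans (ereal_sup_ubound _); last by exists y.
  by rewrite lee_fin residualE// ler_pdivlMr// -mulrA.
have d0 : eqX T (x - xN) 0 by apply: contrapT.
(* when the error vanishes, a nonzero test function is still needed for the
   supremum to be over a nonempty set *)
have [z [[Xz [y Vy zy]] nz]] := adjoint_ansatz_nonzero.
have yY := ansatz_Y Vy; have XB := Bstar_X A yY.
have X0 := @X_0 R T n.
have ny : nonzero T y.
  by move=> y0; apply: nz; apply: eqX_trans zy _; exact: Bstar_eq0.
rewrite (normX_eqX Xd X0 d0) normX_0.
apply: le_trans (ereal_sup_ubound _); last by exists y.
rewrite lee_fin residualE// (innerX_eqX Xd X0 XB d0).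
by rewrite innerX0l// mul0r.
Qed.

End error.
End galerkin.
End ansatz.

(** * Hat functions *)

Section hat_basis.
Context {R : realType} {n : nat} (T : R).
Hypothesis T0 : 0 < T.
Notation mu := (@lebesgue_measure R).
Notation D := (`]0, T[%classic : set R).

(** A continuous function that vanishes almost everywhere vanishes: otherwise it
    is nonzero on an interval of positive measure. *)
Lemma continuous_ae0 (u : R -> R) : {within `[0, T], continuous u} ->
  (\forall t \ae mu, D t -> u t = 0) -> forall t : R, 0 <= t <= T -> u t = 0.
Proof.
move=> cu u0 t tT; apply/eqP/negPn/negP => ut0.
have e0 : 0 < `|u t| / 2 by rewrite divr_gt0// normr_gt0.
have /subspace_continuousP/(_ t) := cu.
rewrite /= in_itv/= => /(_ tT)/cvgrPdist_le/(_ _ e0).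
rewrite near_withinE => /nbhs_ballP[d /= d0 Hd].
have us (s : R) : 0 <= s <= T -> `|t - s| < d -> u s != 0.
  move=> sT ts; apply/eqP => us0.
  have : `|u t - u s| <= `|u t| / 2 by apply: Hd => //; rewrite in_itv.
  rewrite us0 subr0.
  by rewrite ler_pdivlMr// ger_pMr ?normr_gt0// lern1.
pose a := Num.max 0 (t - d); pose c := Num.min T (t + d).
have ac : a < c.
  case/andP: tT => t0 tT; rewrite /a /c lt_min !gt_max -!andbA.
  rewrite T0 ltrBlDr (le_lt_trans tT) ?ltrDl// ltr_wpDl//=.
  by rewrite ltrD2l (lt_trans _ d0)// oppr_lt0.
have mI : measurable (`]a, c[%classic : set (measurableTypeR R)).
  exact: measurable_itv.
have muI : mu `]a, c[%classic = (c - a)%:E.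
  by rewrite lebesgue_measure_itv/= lte_fin ac -EFinB.
have : mu.-negligible (`]a, c[%classic : set (measurableTypeR R)).
  apply: negligibleS u0 => s /=; rewrite in_itv/= gt_max lt_min.
  move=> /andP[/andP[s0 s1] /andP[s2 s3]] H.
  have := us s; rewrite H ?eqxx; last by rewrite in_itv/= s0.
  rewrite !ltW//= => /(_ isT); suff -> : `|t - s| < d by move=> /(_ isT).
  by rewrite ltr_norml ltrBlDr ltrNl opprB ltrBlDr addrC s3 addrC -ltrBlDr.
move/(measure_negligible mI) => H.
by have [/eqP] := eq_trans (esym muI) H; rewrite subr_eq0 gt_eqF.
Qed.

Context (E : 'M[R]_n) (K : nat) (v : (\dim (kerT E)).-tuple 'cV[R]_n).
Hypothesis K0 : (0 < K)%N.
Hypothesis v_basis : basis_of (kerT E) v.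

Let I : finType := (('I_K * 'I_n) + 'I_(\dim (kerT E)))%type.

Definition hat_vector (s : I) : R -> 'cV[R]_n := fun t =>
  match s with
  | inl ki => hat T K ki.1 t *: delta_mx ki.2 ord0
  | inr j => hat T K K t *: tnth v j
  end.

Let node_T : K%:R * (T / K%:R) = T.
Proof. by rewrite mulrCA divff ?mulr1// pnatr_eq0 -lt0n. Qed.

Lemma hat_vector_Y s : Y T E (hat_vector s).
Proof.
split.
  case: s => [[k i]|j] l.
    have := H1_Z ((delta_mx i ord0 : 'cV[R]_n) l ord0) (H1_hat T0 k K0).
    by congr H1; apply/funext => t; rewrite /coord /hat_vector [RHS]mxE mulrC.
  have := H1_Z (tnth v j l ord0) (H1_hat T0 K K0).
  by congr H1; apply/funext => t; rewrite /coord /hat_vector [RHS]mxE mulrC.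
case: s => [[k i]|j]; rewrite /hat_vector/=.
  by have := @hat_node R T K k K T0 K0; rewrite node_T => ->; rewrite ltn_eqF// scale0r mem0v.
by rewrite rpredZ// (basis_mem v_basis)// mem_tnth.
Qed.

Lemma hat_vector_comb (c : I -> R) t : (\sum_s c s *: hat_vector s) t =
  \sum_(k < K) \sum_(i < n) c (inl (k, i)) *: (hat T K k t *: delta_mx i ord0)
  + \sum_j c (inr j) *: (hat T K K t *: tnth v j).
Proof.
rewrite fct_sumE big_sumType/=; congr (_ + _).
by rewrite pair_bigA/=; apply: eq_bigr => -[k i] _.
Qed.

(** Evaluation at the nodes recovers the coefficients. *)
Lemma hat_vector_free (c : I -> R) : eqX T (\sum_s c s *: hat_vector s) 0 ->
  forall s, c s = 0.
Proof.
move=> y0; set y := \sum_s _ in y0.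
have yY : Y T E y by apply: Y_sum => // s; exact: hat_vector_Y.
have yt t : 0 <= t <= T -> y t = 0.
  move=> tT; apply/matrixP => i j; rewrite (ord1 j) mxE -[LHS]/(coord i y t).
  have [_ cy _] := Y_coord i yY; apply: (continuous_ae0 cy) => //.
  by move: y0; apply: ae_mono => s H Ds; rewrite /coord H// mxE.
have d0 : 0 < T / K%:R by rewrite divr_gt0// ltr0n.
have node (l : nat) : (l <= K)%N -> y (l%:R * (T / K%:R)) = 0.
  move=> lK; apply: yt; rewrite mulr_ge0 ?(ltW d0)//= -[leRHS]node_T.
  by rewrite ler_pM2r// ler_nat.
case=> [[k i]|j].
  have := node k (ltnW (ltn_ord k)); rewrite /y hat_vector_comb.
  rewrite [X in _ + X]big1 ?addr0; last first.
    by move=> j _; rewrite hat_node// gtn_eqF// scale0r scaler0.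
  rewrite (bigD1 k)//= [X in _ + X]big1 ?addr0; last first.
    move=> l lk; rewrite big1// => i' _; rewrite hat_node// val_eqE (negbTE lk).
    by rewrite scale0r scaler0.
  move=> /matrixP/(_ i ord0); rewrite summxE mxE (bigD1 i)//= big1 ?addr0.
    by rewrite !mxE hat_node// !eqxx !mulr1.
  by move=> i' ii'; rewrite !mxE eq_sym (negbTE ii') !mulr0.
have := node K (leqnn K); rewrite /y hat_vector_comb.
rewrite [X in X + _]big1 ?add0r; last first.
  by move=> k _; rewrite big1// => i _; rewrite hat_node// ltn_eqF// scale0r scaler0.
rewrite hat_node// eqxx; under eq_bigr do rewrite scale1r.
have /freeP vfree := basis_free v_basis.
move=> H; apply: (vfree (fun j => c (inr j))).
by rewrite -[RHS]H; apply: eq_bigr => l _; rewrite (tnth_nth 0).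
Qed.

Let N := (n * K + \dim (kerT E))%N.

Let card_I : #|I| = N.
Proof. by rewrite card_sum card_prod !card_ord mulnC. Qed.

Definition hat_basis (l : 'I_N) : R -> 'cV[R]_n :=
  hat_vector (enum_val (cast_ord (esym card_I) l)).

Lemma hat_basis_sum (c : 'I_N -> R) : \sum_l c l *: hat_basis l =
  \sum_s c (cast_ord card_I (enum_rank s)) *: hat_vector s.
Proof.
rewrite (reindex (fun s : I => cast_ord card_I (enum_rank s))) /=.
  by apply: eq_bigr => s _; rewrite /hat_basis cast_ordK enum_rankK.
exists (fun l => enum_val (cast_ord (esym card_I) l)) => l _.
  by rewrite cast_ordK enum_rankK.
by rewrite enum_valK cast_ordKV.
Qed.

Lemma hat_basis_Y l : Y T E (hat_basis l).
Proof. exact: hat_vector_Y. Qed.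

Lemma hat_basis_free (c : 'I_N -> R) : eqX T (\sum_l c l *: hat_basis l) 0 ->
  forall l, c l = 0.
Proof.
rewrite hat_basis_sum => /hat_vector_free H l.
by have := H (enum_val (cast_ord (esym card_I) l)); rewrite enum_valK cast_ordKV.
Qed.

Lemma YN_ansatz : YN T K v = ansatz hat_basis.
Proof.
apply/seteqP; split => [_ [c [a ->]]|_ [c ->]].
  pose e (s : I) := match s with inl ki => c ki.1 ki.2 | inr j => a j end.
  exists (fun l => e (enum_val (cast_ord (esym card_I) l))).
  rewrite hat_basis_sum; apply/funext => t; rewrite hat_vector_comb.
  by congr (_ + _); [apply: eq_bigr => k _; apply: eq_bigr => i _|apply: eq_bigr => j _];
    rewrite cast_ordK enum_rankK.
pose e (s : I) := c (cast_ord card_I (enum_rank s)).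
exists (fun k i => e (inl (k, i))), (fun j => e (inr j)).
by rewrite hat_basis_sum; apply/funext => t; rewrite hat_vector_comb.
Qed.

End hat_basis.

Arguments hat_basis {R n} T {E} K v _ _.

Theorem mainTheorem2 (R : realType) (n : nat) (T : R) (p : nat)
    (P : set 'rV[R]_p) (E : 'M[R]_n) (A : 'rV[R]_p -> 'M[R]_n) (K : nat)
    (v : (\dim (kerT E)).-tuple 'cV[R]_n)
    (mu : 'rV[R]_p) (f : (R -> 'cV[R]_n) -> R) :
  (0 < n)%N -> 0 < T -> compact P ->
  (forall nu, P nu -> exists lambda : R, \det (lambda *: E - A nu) != 0) ->
  (0 < K)%N -> basis_of (kerT E) v ->
  P mu -> dualY T E (A mu) f ->
  let XmuN := XN T E (A mu) K v in
  let YN := YN T K v in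
  let bmu := b T E (A mu) in
  let galerkin := fun xN => XmuN xN /\ forall y, YN y -> bmu xN y = f y in
  [/\ has_dim T XmuN (n * K + \dim (kerT E)) /\
        has_dim T YN (n * K + \dim (kerT E)),
      exists2 xN, galerkin xN & forall z, galerkin z -> eqX T z xN,
      [/\ betaN T E (A mu) K v = 1%E, beta T E (A mu) = 1%E &
          gamma T E (A mu) = 1%E] &
      forall x, X T x -> (forall y, Y T E y -> bmu x y = f y) ->
      forall xN, galerkin xN ->
        (normX T (x - xN))%:E = ereal_inf [set (normX T (x - w))%:E | w in XmuN]
        /\ (normX T (x - xN))%:E = dual_norm T E (A mu) (residual T E (A mu) f xN)].
Proof.
move=> n0 T0 _ regular K0 v_basis Pmu fdual XmuN V bmu gal.
have reg := regular _ Pmu.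
have N0 : (0 < n * K + \dim (kerT E))%N by rewrite ltn_addr// muln_gt0 n0.
have FY := hat_basis_Y T0 K0 v_basis.
have Ffree := hat_basis_free T0 K0 v_basis.
have VE : V = ansatz (hat_basis T K v) := YN_ansatz T K v.
have XE : XmuN = adjoint_ansatz T E (A mu) (hat_basis T K v).
  by rewrite /XmuN /XN -/V VE.
have galE : gal = galerkin T E (A mu) (hat_basis T K v) f.
  by rewrite /gal /galerkin VE XE.
rewrite galE VE XE; split.
- split; first exact: has_dim_adjoint_ansatz.
  exact: has_dim_ansatz.
- have [xN xNf] := galerkin_exists T0 reg FY Ffree fdual.
  by exists xN => // z; exact: galerkin_unique.
- split.
  + by rewrite /betaN -/XmuN -/V XE VE; exact: betaN_eq1.
  + exact: (beta_eq1 T0 reg N0 FY Ffree).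
  + have [x [[Xx _] nx]] := adjoint_ansatz_nonzero T0 reg N0 FY Ffree.
    by apply: gamma_eq1 => //; exists x.
- move=> x Xx xf xN xNf; split; first exact: (galerkin_best T0 FY Xx xf xNf).
  exact: (error_residual T0 reg N0 FY Ffree Xx xf xNf).
Qed.
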